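(* Let $Z_2,Z_{12},Z_{20},Z_{30}$, $Z_j^{*}$ and $P_1,\dots,P_4$ be the polynomials in ${\tt u}=(u_1,u_2,u_3,u_4)$ defined in the context, put $Y_j=Z_j^{*}(P_1({\tt u}),P_2({\tt u}),P_3({\tt u}),P_4({\tt u}))$ for $j=2,12,20,30$, and regard each $Y_j$ as a polynomial in $Z_2,Z_{12},Z_{20},Z_{30}$. Substitute in these polynomials $$\begin{aligned} Z_2&=-w_0,\\ Z_{12}&=\frac{-t_1-10w_0^7}{105w_0},\\ Z_{20}&=\tfrac{4}{33075}(t_2+35t_1w_0^3+105w_0^{10}),\\ Z_{30}&=-\tfrac{4}{10418625}(20t_4+210t_1^2w_0+112t_2w_0^5+2975t_1w_0^8+5320w_0^{15}), \end{aligned}$$ where $t_1,t_2,t_4,w_0$ are independent variables. Then $Y_2$, $w_0^7Y_{12}$, $w_0^{10}Y_{20}$ and $w_0^{15}Y_{30}$ are polynomials of $t_1,t_2,t_4,w_0$.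
   Context: Put $\epsilon_1=u_1^2+u_2^2+u_3^2$, $\epsilon_2=u_1^2u_2^2+u_1^2u_3^2+u_2^2u_3^2$, $\epsilon_3=u_1^2u_2^2u_3^2$, $\delta=(u_1^2-u_2^2)(u_1^2-u_3^2)(u_2^2-u_3^2)$, and $$h_2=\epsilon_1,\quad h_6=-11\epsilon_3+\epsilon_1\epsilon_2+\sqrt5\,\delta,\quad h_{10}=95\epsilon_2\epsilon_3-32\epsilon_1^2\epsilon_3-5\epsilon_1\epsilon_2^2+2\epsilon_1^3\epsilon_2+3\sqrt5\,\epsilon_2\delta,$$ polynomials in $(u_1,u_2,u_3)$. Define polynomials in ${\tt u}=(u_1,u_2,u_3,u_4)$: $$\begin{aligned} Z_2={}&h_2+u_4^2,\\ Z_{12}={}&-h_{10}h_2+\tfrac32h_6^2+(11h_{10}-2h_2^5)u_4^2+(6h_2^4-33h_2h_6)u_4^4-(14h_2^3-33h_6)u_4^6+6h_2^2u_4^8-2h_2u_4^{10},\\ Z_{20}={}&\tfrac12(2h_{10}^2-3h_2h_6^3)+\tfrac12(8h_{10}h_2^4-42h_2^3h_6^2+57h_6^3)u_4^2\\ &-2(38h_{10}h_2^3-2h_2^8+57h_{10}h_6-15h_2^5h_6-84h_2^2h_6^2)u_4^4\\ &+2h_2(148h_{10}h_2-10h_2^6-69h_2^3h_6-153h_6^2)u_4^6\\ &-2(232h_{10}h_2-22h_2^6-201h_2^3h_6-147h_6^2)u_4^8+2(90h_{10}-22h_2^5-201h_2^2h_6)u_4^{10}\\ &+2h_2(22h_2^3+69h_6)u_4^{12}-10(2h_2^3+3h_6)u_4^{14}+4h_2^2u_4^{16},\\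 Z_{30}={}&\tfrac1{15}(20h_{10}^3-45h_{10}h_2h_6^3+27h_6^5)\\ &+(8h_{10}^2h_2^4-42h_{10}h_2^3h_6^2-87h_{10}h_6^3-6h_2^5h_6^3+135h_2^2h_6^4)u_4^2\\ &+(-152h_{10}^2h_2^3+16h_{10}h_2^8+348h_{10}^2h_6+60h_{10}h_2^5h_6+408h_{10}h_2^2h_6^2-84h_2^7h_6^2+84h_2^4h_6^3-909h_2h_6^4)u_4^4\\ &+\tfrac23(1752h_{10}^2h_2^2-516h_{10}h_2^7+16h_2^{12}-3258h_{10}h_2^4h_6+180h_2^9h_6-2862h_{10}h_2h_6^2\\ &\qquad+1998h_2^6h_6^2+432h_2^3h_6^3+3591h_6^4)u_4^6\\ &-2(1616h_{10}^2h_2-1072h_{10}h_2^6+40h_2^{11}-5454h_{10}h_2^3h_6+336h_2^8h_6+453h_{10}h_6^2+3462h_2^5h_6^2+978h_2^2h_6^3)u_4^8\\ &+\tfrac25(8100h_{10}^2-17900h_{10}h_2^5+672h_2^{10}-63330h_{10}h_2^2h_6+4020h_2^7h_6+49920h_2^4h_6^2+18375h_2h_6^3)u_4^{10}\\ &+\tfrac43(10662h_{10}h_2^4-332h_2^9+17631h_{10}h_2h_6-936h_2^6h_6-20547h_2^3h_6^2-4347h_6^3)u_4^{12}\\ &-4(4214h_{10}h_2^3-68h_2^8+1905h_{10}h_6-4647h_2^2h_6^2)u_4^{14}\\ &+4h_2(2506h_{10}h_2+68h_2^6+312h_2^3h_6-1407h_6^2)u_4^{16}\\ &-\tfrac83(1080h_{10}h_2+166h_2^6+603h_2^3h_6-405h_6^2)u_4^{18}\\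 &+\tfrac{24}5(75h_{10}+56h_2^5+140h_2^2h_6)u_4^{20}-40h_2(2h_2^3+3h_6)u_4^{22}+\tfrac{32}3h_2^3u_4^{24}. \end{aligned}$$ These are algebraically independent generators of the ring of invariants of the reflection group of type $H_4$ acting on $\mathbb{C}[u_1,u_2,u_3,u_4]$. Let $k_2,k_6,k_{10}$ be obtained from $h_2,h_6,h_{10}$ by replacing $\sqrt5$ by $-\sqrt5$, and let $Z_j^{*}=Z_j^{*}(u_1,u_2,u_3,u_4)$ be obtained from $Z_j$ by replacing $h_2,h_6,h_{10}$ by $k_2,k_6,k_{10}$ ($j=2,12,20,30$). Let $$f(u_1,u_2,u_3,u_4)=\tfrac1{168}u_4\left(-21h_6+14h_2^2u_4^2-14h_2u_4^4+2u_4^6\right)$$ with $h_2,h_6$ evaluated at $(u_1,u_2,u_3)$, and $$P_1({\tt u})=f(u_4,u_3,u_2,u_1),\quad P_2({\tt u})=f(u_3,u_4,u_1,u_2),\quad P_3({\tt u})=f(u_2,u_1,u_4,u_3),\quad P_4({\tt u})=f(u_1,u_2,u_3,u_4).$$ Each $Y_j=Z_j^{*}(P_1,P_2,P_3,P_4)$ is invariant under the reflection group of type $H_4$, hence is a (unique) polynomial in $Z_2,Z_{12},Z_{20},Z_{30}$; this polynomial is the one into which the substitution is made. Background: $(t_1,t_2,t_3,t_4)$ are flat coordinates of the algebraic Frobenius prepotential $H_4(9)$, and $w_0$ is the algebraic function with $\frac3{20}t_1^2-t_3w_0^2+\frac15t_2w_0^4+\frac85t_1w_0^7+w_0^{14}=0$,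 by which $t_3$ is eliminated. *)

(* Defs.v *)
From mathcomp Require Import all_boot all_order all_algebra fraction.
From mathcomp Require Import reals complex mpoly.

Set Implicit Arguments.
Unset Strict Implicit.
Unset Printing Implicit Defensive.

Import Order.TTheory GRing.Theory Num.Theory.
Local Open Scope ring_scope.

(* Large integer coefficients are written [n%:R] with [n] parsed in [nat_scope]:
   from 5001 on, such a literal is kept in decimal form ([Nat.of_num_uint]),
   whereas a bare numeral in [ring_scope] is always unary. *)

Local Notation u1 := 'X_(@Ordinal 4 0 isT).
Local Notation u2 := 'X_(@Ordinal 4 1 isT).
Local Notation u3 := 'X_(@Ordinal 4 2 isT).
Local Notation u4 := 'X_(@Ordinal 4 3 isT).

Definition eps1 (C : numClosedFieldType) : {mpoly C[4]} :=
  u1 ^+ 2 + u2 ^+ 2 + u3 ^+ 2.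
Definition eps2 (C : numClosedFieldType) : {mpoly C[4]} :=
  u1 ^+ 2 * u2 ^+ 2 + u1 ^+ 2 * u3 ^+ 2 + u2 ^+ 2 * u3 ^+ 2.
Definition eps3 (C : numClosedFieldType) : {mpoly C[4]} :=
  u1 ^+ 2 * u2 ^+ 2 * u3 ^+ 2.
Definition delta (C : numClosedFieldType) : {mpoly C[4]} :=
  (u1 ^+ 2 - u2 ^+ 2) * (u1 ^+ 2 - u3 ^+ 2) * (u2 ^+ 2 - u3 ^+ 2).

(* [s] is the square root of 5 that occurs in the coefficients: [s = sqrtC 5]
   gives h_2, h_6, h_10 and [s = - sqrtC 5] gives k_2, k_6, k_10. *)
Definition h2 (C : numClosedFieldType) (s : C) : {mpoly C[4]} := eps1 C.
Definition h6 (C : numClosedFieldType) (s : C) : {mpoly C[4]} :=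
  - (11 * eps3 C) + eps1 C * eps2 C + s *: delta C.
Definition h10 (C : numClosedFieldType) (s : C) : {mpoly C[4]} :=
  95 * eps2 C * eps3 C - 32 * eps1 C ^+ 2 * eps3 C
  - 5 * eps1 C * eps2 C ^+ 2 + 2 * eps1 C ^+ 3 * eps2 C
  + (3 * s) *: (eps2 C * delta C).

Definition Z2 (C : numClosedFieldType) (s : C) : {mpoly C[4]} :=
  let h2 := h2 s in
  h2 + u4 ^+ 2.

Definition Z12 (C : numClosedFieldType) (s : C) : {mpoly C[4]} :=
  let h2 := h2 s in let h6 := h6 s in let h10 := h10 s in
  - (h10 * h2) + (3 / 2) *: h6 ^+ 2
  + (11 * h10 - 2 * h2 ^+ 5) * u4 ^+ 2
  + (6 * h2 ^+ 4 - 33 * h2 * h6) * u4 ^+ 4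
  - (14 * h2 ^+ 3 - 33 * h6) * u4 ^+ 6
  + 6 * h2 ^+ 2 * u4 ^+ 8
  - 2 * h2 * u4 ^+ 10.

Definition Z20 (C : numClosedFieldType) (s : C) : {mpoly C[4]} :=
  let h2 := h2 s in let h6 := h6 s in let h10 := h10 s in
  (1 / 2) *: (2 * h10 ^+ 2 - 3 * h2 * h6 ^+ 3)
  + (1 / 2) *: (8 * h10 * h2 ^+ 4 - 42 * h2 ^+ 3 * h6 ^+ 2 + 57 * h6 ^+ 3)
      * u4 ^+ 2
  - 2 * (38 * h10 * h2 ^+ 3 - 2 * h2 ^+ 8 + 57 * h10 * h6
         - 15 * h2 ^+ 5 * h6 - 84 * h2 ^+ 2 * h6 ^+ 2) * u4 ^+ 4
  + 2 * h2 * (148 * h10 * h2 - 10 * h2 ^+ 6 - 69 * h2 ^+ 3 * h6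
              - 153 * h6 ^+ 2) * u4 ^+ 6
  - 2 * (232 * h10 * h2 - 22 * h2 ^+ 6 - 201 * h2 ^+ 3 * h6
         - 147 * h6 ^+ 2) * u4 ^+ 8
  + 2 * (90 * h10 - 22 * h2 ^+ 5 - 201 * h2 ^+ 2 * h6) * u4 ^+ 10
  + 2 * h2 * (22 * h2 ^+ 3 + 69 * h6) * u4 ^+ 12
  - 10 * (2 * h2 ^+ 3 + 3 * h6) * u4 ^+ 14
  + 4 * h2 ^+ 2 * u4 ^+ 16.

Definition Z30 (C : numClosedFieldType) (s : C) : {mpoly C[4]} :=
  let h2 := h2 s in let h6 := h6 s in let h10 := h10 s in
  (1 / 15) *: (20 * h10 ^+ 3 - 45 * h10 * h2 * h6 ^+ 3 + 27 * h6 ^+ 5)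
  + (8 * h10 ^+ 2 * h2 ^+ 4 - 42 * h10 * h2 ^+ 3 * h6 ^+ 2
     - 87 * h10 * h6 ^+ 3 - 6 * h2 ^+ 5 * h6 ^+ 3
     + 135 * h2 ^+ 2 * h6 ^+ 4) * u4 ^+ 2
  + (- (152 * h10 ^+ 2 * h2 ^+ 3) + 16 * h10 * h2 ^+ 8
     + 348 * h10 ^+ 2 * h6 + 60 * h10 * h2 ^+ 5 * h6
     + 408 * h10 * h2 ^+ 2 * h6 ^+ 2 - 84 * h2 ^+ 7 * h6 ^+ 2
     + 84 * h2 ^+ 4 * h6 ^+ 3 - 909 * h2 * h6 ^+ 4) * u4 ^+ 4
  + (2 / 3) *: (1752%:R * h10 ^+ 2 * h2 ^+ 2 - 516 * h10 * h2 ^+ 7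
     + 16 * h2 ^+ 12 - 3258%:R * h10 * h2 ^+ 4 * h6
     + 180 * h2 ^+ 9 * h6 - 2862%:R * h10 * h2 * h6 ^+ 2
     + 1998%:R * h2 ^+ 6 * h6 ^+ 2 + 432 * h2 ^+ 3 * h6 ^+ 3
     + 3591%:R * h6 ^+ 4) * u4 ^+ 6
  - 2 * (1616%:R * h10 ^+ 2 * h2 - 1072%:R * h10 * h2 ^+ 6
     + 40 * h2 ^+ 11 - 5454%:R * h10 * h2 ^+ 3 * h6
     + 336 * h2 ^+ 8 * h6 + 453 * h10 * h6 ^+ 2
     + 3462%:R * h2 ^+ 5 * h6 ^+ 2 + 978 * h2 ^+ 2 * h6 ^+ 3) * u4 ^+ 8
  + (2 / 5) *: (8100%:R * h10 ^+ 2 - 17900%:R * h10 * h2 ^+ 5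
     + 672 * h2 ^+ 10 - 63330%:R * h10 * h2 ^+ 2 * h6
     + 4020%:R * h2 ^+ 7 * h6 + 49920%:R * h2 ^+ 4 * h6 ^+ 2
     + 18375%:R * h2 * h6 ^+ 3) * u4 ^+ 10
  + (4 / 3) *: (10662%:R * h10 * h2 ^+ 4 - 332 * h2 ^+ 9
     + 17631%:R * h10 * h2 * h6 - 936 * h2 ^+ 6 * h6
     - 20547%:R * h2 ^+ 3 * h6 ^+ 2 - 4347%:R * h6 ^+ 3) * u4 ^+ 12
  - 4 * (4214%:R * h10 * h2 ^+ 3 - 68 * h2 ^+ 8
     + 1905%:R * h10 * h6 - 4647%:R * h2 ^+ 2 * h6 ^+ 2) * u4 ^+ 14
  + 4 * h2 * (2506%:R * h10 * h2 + 68 * h2 ^+ 6 + 312 * h2 ^+ 3 * h6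
     - 1407%:R * h6 ^+ 2) * u4 ^+ 16
  - (8 / 3) *: (1080%:R * h10 * h2 + 166 * h2 ^+ 6
     + 603 * h2 ^+ 3 * h6 - 405 * h6 ^+ 2) * u4 ^+ 18
  + (24 / 5) *: (75 * h10 + 56 * h2 ^+ 5 + 140 * h2 ^+ 2 * h6) * u4 ^+ 20
  - 40 * h2 * (2 * h2 ^+ 3 + 3 * h6) * u4 ^+ 22
  + (32 / 3) *: h2 ^+ 3 * u4 ^+ 24.

Definition f (C : numClosedFieldType) : {mpoly C[4]} :=
  let h2 := h2 (sqrtC 5) in let h6 := h6 (sqrtC 5) in
  (1 / 168) *: u4 * (- (21 * h6) + 14 * h2 ^+ 2 * u4 ^+ 2
                     - 14 * h2 * u4 ^+ 4 + 2 * u4 ^+ 6).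

Definition P1 (C : numClosedFieldType) : {mpoly C[4]} :=
  f C \mPo [tuple u4; u3; u2; u1].
Definition P2 (C : numClosedFieldType) : {mpoly C[4]} :=
  f C \mPo [tuple u3; u4; u1; u2].
Definition P3 (C : numClosedFieldType) : {mpoly C[4]} :=
  f C \mPo [tuple u2; u1; u4; u3].
Definition P4 (C : numClosedFieldType) : {mpoly C[4]} :=
  f C \mPo [tuple u1; u2; u3; u4].

Definition P (C : numClosedFieldType) : 4.-tuple {mpoly C[4]} :=
  [tuple P1 C; P2 C; P3 C; P4 C].

Definition Y2 (C : numClosedFieldType) : {mpoly C[4]} :=
  Z2 (- sqrtC 5) \mPo P C.
Definition Y12 (C : numClosedFieldType) : {mpoly C[4]} :=
  Z12 (- sqrtC 5) \mPo P C.
Definition Y20 (C : numClosedFieldType) : {mpoly C[4]} :=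
  Z20 (- sqrtC 5) \mPo P C.
Definition Y30 (C : numClosedFieldType) : {mpoly C[4]} :=
  Z30 (- sqrtC 5) \mPo P C.

Definition Z (C : numClosedFieldType) : 4.-tuple {mpoly C[4]} :=
  [tuple Z2 (sqrtC 5); Z12 (sqrtC 5); Z20 (sqrtC 5); Z30 (sqrtC 5)].

(* [Q] is the polynomial in Z_2, Z_12, Z_20, Z_30 that equals [Y]. *)
Definition is_expression_in_Z (C : numClosedFieldType) (Y Q : {mpoly C[4]}) :
    Prop :=
  unique (fun q : {mpoly C[4]} => q \mPo Z C = Y) Q.

(* From here on the four variables of [{mpoly C[4]}] are t1, t2, t4, w0, in this
   order, and its fraction field is C(t1, t2, t4, w0). *)Definition t1 (C : numClosedFieldType) : {fraction {mpoly C[4]}} :=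
  tofrac 'X_(@Ordinal 4 0 isT).
Definition t2 (C : numClosedFieldType) : {fraction {mpoly C[4]}} :=
  tofrac 'X_(@Ordinal 4 1 isT).
Definition t4 (C : numClosedFieldType) : {fraction {mpoly C[4]}} :=
  tofrac 'X_(@Ordinal 4 2 isT).
Definition w0 (C : numClosedFieldType) : {fraction {mpoly C[4]}} :=
  tofrac 'X_(@Ordinal 4 3 isT).

Definition Zsubst (C : numClosedFieldType) : 4.-tuple {fraction {mpoly C[4]}} :=
  let t1 := t1 C in let t2 := t2 C in let t4 := t4 C in let w0 := w0 C in
  [tuple
    - w0;
    (- t1 - 10 * w0 ^+ 7) / (105 * w0);
    4 / 33075%:R * (t2 + 35 * t1 * w0 ^+ 3 + 105 * w0 ^+ 10);
    - (4 / 10418625%:R) *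
      (20 * t4 + 210 * t1 ^+ 2 * w0 + 112 * t2 * w0 ^+ 5
       + 2975%:R * t1 * w0 ^+ 8 + 5320%:R * w0 ^+ 15)].

Definition substZ (C : numClosedFieldType) (Q : {mpoly C[4]}) :
    {fraction {mpoly C[4]}} :=
  mmap (fun c : C => tofrac c%:MP) (tnth (Zsubst C)) Q.

Definition is_polynomial (C : numClosedFieldType)
    (x : {fraction {mpoly C[4]}}) : Prop :=
  exists p : {mpoly C[4]}, x = tofrac p.

(* Main.v *)
Require Import Defs.
From HB Require Import structures.
From mathcomp Require Import all_boot all_order all_algebra fraction.
From mathcomp Require Import reals complex mpoly ring zify.

Set Implicit Arguments.
Unset Strict Implicit.
Unset Printing Implicit Defensive.

Import Order.TTheory GRing.Theory Num.Theory.
Local Open Scope ring_scope.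

(** The substitution u -> (P1, ..., P4) intertwines the reflection
    representation of H4 with its conjugate under sqrt 5 -> - sqrt 5, so
    each Y_j is an invariant of H4. It is a polynomial in the Z's by a
    Jacobian argument: the determinant J = det (dZ_i / du_j) is anti-
    invariant, hence divisible by the 60 mirrors, and by degree it is a
    nonzero multiple of their product. For an invariant Y the numerators in
    Cramer's rule for dY / dZ_i are anti-invariant as well, hence divisible
    by J: the dY / dZ_i are polynomial invariants of smaller degree, and
    Euler's identity deg Y * Y = sum_i deg Z_i * Z_i * dY / dZ_i concludes
    by induction. Uniqueness follows from J != 0. Finally Q_j is weighted
    homogeneous of weight 7 j, and a monomial Z2^a Z12^b Z20^c Z30^d has in
    w_0 a pole of order at most b - a, which the weight bounds by 0, 7, 10,
    15. *)

(** The finite group itself never appears: there is no averaging and no count of its elements, only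
    four generators. The flip of [u4] makes an anti-invariant divisible by [u4], and the relation
    [p = \det (jac g) * (p \mPo g)] carries this divisibility along the orbit of the form [u4]. That
    orbit is enumerated with integer arithmetic in Z[phi]; its 60 forms match the degree 1 + 11 + 19
    + 29 of J, which is why J can only be a constant times their product. Expanding J is avoided as
    well. The Z's are polynomials in [h2], [h6], [h10] and [u4 ^+ 2], so J is a product of two
    determinants, each of which needs only derivatives at one well-chosen point. The exponents 7,
    10, 15 are the best that the weight gives: Z12^7, Z12^10 Z20 and Z12^15 Z30 have weights 84, 140
    and 210. *)

Lemma mpoly_ring_ind (n : nat) (R : comNzRingType) (Pr : {mpoly R[n]} -> Prop) :
    (forall c, Pr c%:MP) -> (forall i, Pr 'X_i) ->
    (forall p q, Pr p -> Pr q -> Pr (p + q)) ->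
    (forall p q, Pr p -> Pr q -> Pr (p * q)) ->
  forall p, Pr p.
Proof.
move=> PC PX PD PM; elim/mpolyind => [|c m p _ _ Pp]; first by rewrite -mpolyC0.
apply: (PD) => //; rewrite -mul_mpolyC; apply: (PM) => //.
rewrite mpolyXE_id; apply: (big_ind Pr) => // [|i _]; first by rewrite -mpolyC1.
elim: (m i) => [|k IHk]; first by rewrite expr0 -mpolyC1.
by rewrite exprS; apply: PM.
Qed.

(** * Composition of polynomial maps and the chain rule *)

Definition tcomp (k n l : nat) (R : comNzRingType) (t : k.-tuple {mpoly R[n]})
    (g : n.-tuple {mpoly R[l]}) : k.-tuple {mpoly R[l]} :=
  [tuple tnth t i \mPo g | i < k].

Lemma comp_mpolyA (k n l : nat) (R : comNzRingType) (p : {mpoly R[k]})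
    (t : k.-tuple {mpoly R[n]}) (g : n.-tuple {mpoly R[l]}) :
  (p \mPo t) \mPo g = p \mPo tcomp t g.
Proof.
elim/mpoly_ring_ind: p => [c|i|p q Hp Hq|p q Hp Hq].
- by rewrite !comp_mpolyC.
- by rewrite !comp_mpolyXU -!tnth_nth tnth_mktuple.
- by rewrite !comp_mpolyD Hp Hq.
- by rewrite !rmorphM /= Hp Hq.
Qed.

Section Jacobian.

Variables (R : comNzRingType).

Definition grad (n : nat) (p : {mpoly R[n]}) : 'rV[{mpoly R[n]}]_n :=
  \row_j p^`M(j).

Definition jac (k n : nat) (t : k.-tuple {mpoly R[n]}) :
    'M[{mpoly R[n]}]_(k, n) :=
  \matrix_(i, j) (tnth t i)^`M(j).

Lemma mderivXU (n : nat) (i j : 'I_n) :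
  ('X_i : {mpoly R[n]})^`M(j) = (i == j)%:R.
Proof.
rewrite mderivX mnm1E; case: eqP => [->|_] /=; last by rewrite scale0r.
by rewrite -{1}[U_(j)%MM]add0m addmK scale1r mpolyX0.
Qed.

Lemma grad_comp (k n : nat) (p : {mpoly R[k]}) (t : k.-tuple {mpoly R[n]}) :
  grad (p \mPo t) = map_mx (comp_mpoly t) (grad p) *m jac t.
Proof.
apply/rowP => j; rewrite !mxE.
under eq_bigr do rewrite !mxE.
elim/mpoly_ring_ind: p => [c|i|p q Hp Hq|p q Hp Hq].
- rewrite comp_mpolyC mderivC big1 // => i _.
  by rewrite mderivC comp_mpoly0 mul0r.
- rewrite comp_mpolyXU -tnth_nth (bigD1 i) //= mderivXU eqxx rmorph1 mul1r.
  rewrite big1 ?addr0 // => i' /negbTE Hi'.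
  by rewrite mderivXU eq_sym Hi' rmorph0 mul0r.
- rewrite comp_mpolyD mderivD Hp Hq -big_split /=.
  by apply: eq_bigr => i _; rewrite mderivD comp_mpolyD mulrDl.
- rewrite rmorphM /= mderivM Hp Hq mulr_suml mulr_sumr -big_split /=.
  apply: eq_bigr => i _; rewrite mderivM comp_mpolyD !rmorphM /= mulrDl.
  by rewrite mulrAC mulrA.
Qed.

Lemma row_jac (k n : nat) (t : k.-tuple {mpoly R[n]}) (i : 'I_k) :
  row i (jac t) = grad (tnth t i).
Proof. by apply/rowP => j; rewrite !mxE. Qed.

Lemma jac_comp (k n l : nat) (t : k.-tuple {mpoly R[n]})
    (g : n.-tuple {mpoly R[l]}) :
  jac (tcomp t g) = map_mx (comp_mpoly g) (jac t) *m jac g.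
Proof.
apply/row_matrixP => i.
by rewrite row_jac tnth_mktuple grad_comp row_mul -map_row row_jac.
Qed.

End Jacobian.

(** * Homogeneous polynomials and graded components *)

Section Homogeneous.

Variables (n : nat) (R : comNzRingType).

Lemma mderiv_dhomog (d : nat) (p : {mpoly R[n]}) (j : 'I_n) :
  p \is d.-homog -> p^`M(j) \is d.-1.-homog.
Proof.
move=> /dhomogP Hp; apply/dhomogP => m; rewrite mcoeff_msupp mcoeff_mderiv => H.
have /Hp : (m + U_(j))%MM \in msupp p.
  by rewrite mcoeff_msupp; apply: contraNneq H => ->; rewrite mul0rn.
by rewrite /= mdegD mdeg1 addn1 => <-.
Qed.

Lemma euler_dhomog (d : nat) (p : {mpoly R[n]}) :
  p \is d.-homog -> \sum_j p^`M(j) * 'X_j = d%:R *: p.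
Proof.
move=> /dhomogP Hp.
have {2}-> : p = \sum_(m <- msupp p) p@_m *: 'X_[m] by exact: mpolyE.
under eq_bigr => j _ do rewrite {1}[p]mpolyE raddf_sum mulr_suml /=.
rewrite exchange_big scaler_sumr /= big_seq [RHS]big_seq.
apply: eq_bigr => m Hm; rewrite -(Hp m Hm) /= mdegE natr_sum scaler_suml.
apply: eq_bigr => j _; rewrite mderivZ mderivX.
have [Hj|Hj] := posnP (m j); first by rewrite Hj !scale0r scaler0 mul0r.
rewrite -!scalerAl -mpolyXD submK ?scalerA 1?mulrC //.
by rewrite lep1mP -lt0n.
Qed.

Lemma prod_dhomog (I : Type) (mf : measure n) (r : seq I) (P : pred I)
    (F : I -> {mpoly R[n]}) (e : I -> nat) :
  (forall i, F i \is (e i).-homog for mf) ->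
  \prod_(i <- r | P i) F i \is (\sum_(i <- r | P i) e i)%N.-homog for mf.
Proof.
move=> H; elim: r => [|i r IHr]; first by rewrite !big_nil dhomog1.
by rewrite !big_cons; case: (P i) => //; apply: dhomogM.
Qed.

Lemma det_dhomog (A : 'M[{mpoly R[n]}]_n) (e : 'I_n -> nat) :
  (forall i j, A i j \is (e i).-homog) -> \det A \is (\sum_i e i)%N.-homog.
Proof.
move=> HA; apply: rpred_sum => s _; rewrite -signr_odd mulr_sign.
by case: ifP => _; rewrite ?rpredN; apply: prod_dhomog.
Qed.

Lemma comp_dhomog (k : nat) (mf : measure k) (d e : nat) (p : {mpoly R[k]})
    (t : k.-tuple {mpoly R[n]}) :
  (forall i, tnth t i \is (mf U_(i)%MM * e)%N.-homog) ->
  p \is d.-homog for mf -> p \mPo t \is (d * e)%N.-homog.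
Proof.
move=> Ht /dhomogP Hp; rewrite comp_mpolyE big_seq.
apply: rpred_sum => m Hm; apply: rpredZ; rewrite -(Hp _ Hm).
suff -> : (mf m * e = \sum_(i < k) (mf U_(i)%MM * e) * m i)%N.
  by apply: prod_dhomog => i; apply: dhomogMn.
rewrite mfE big_distrl; apply: eq_bigr => i _ /=.
by rewrite -mulnA mulnC.
Qed.

(** Meant for a factor [p] not known to be homogeneous: multiplication by [q] shifts each of its
    components by [e], and nothing lands below degree [e]. *)
Lemma pihomogM (mf : measure n) (d e : nat) (p q : {mpoly R[n]}) :
  q \is e.-homog for mf ->
  pihomog mf d (p * q) = if (e <= d)%N then pihomog mf (d - e) p * q else 0.
Proof.
move=> Hq; rewrite {1}[p]mpolyE mulr_suml raddf_sum /=.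
have HX m : 'X_[m] * q \is (mf m + e)%N.-homog for mf.
  by apply: dhomogM => //; rewrite dhomogX.
rewrite (eq_bigr (fun m =>
    if (mf m + e == d)%N then p@_m *: 'X_[m] * q else 0)).
  rewrite -big_mkcond /=; case: leqP => Hed.
    rewrite /pihomog mulr_suml; apply: eq_bigl => m.
    by rewrite -{1}(subnK Hed) eqn_add2r.
  by rewrite big_pred0 // => m; apply/negbTE; rewrite neq_ltn ltn_addl ?orbT.
move=> m _; rewrite -scalerAl linearZ /=; case: eqP => [<-|/eqP Hm].
  by rewrite pihomog_dE // scalerAl.
by rewrite (pihomog_ne0 Hm (HX m)) scaler0.
Qed.

(** A linear substitution preserves degrees. Consequently the components of an invariant are
    invariant. *)
Lemma pihomog_comp (k d : nat) (p : {mpoly R[k]})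
    (g : k.-tuple {mpoly R[n]}) :
  (forall i, tnth g i \is 1.-homog) ->
  pihomog mdeg d (p \mPo g) = pihomog mdeg d p \mPo g.
Proof.
move=> Hg; rewrite {1}[p]mpolyE [pihomog _ d p]pihomogE.
rewrite !(raddf_sum (comp_mpoly g)) raddf_sum /= [RHS]big_mkcond /=.
apply: eq_bigr => m _.
rewrite comp_mpolyZ linearZ /=.
have HX : 'X_[m] \mPo g \is (mdeg m).-homog.
  rewrite -[mdeg m]muln1; apply: comp_dhomog => [i|]; last by rewrite dhomogX.
  by rewrite /= mdeg1 mul1n.
case: eqP => [Hm|/eqP Hm].
  by rewrite pihomog_dE -?Hm // comp_mpolyZ.
by rewrite (pihomog_ne0 Hm HX) scaler0.
Qed.

End Homogeneous.

(** * Divisibility by linear forms *)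

Section LinearForms.

Variables (n : nat) (K : fieldType).
Implicit Types (p q l : {mpoly K[n]}) (a b : 'I_n -> K).

Definition divides l p := exists q, p = q * l.

Lemma dividesD l p q : divides l p -> divides l q -> divides l (p + q).
Proof. by move=> [p' ->] [q' ->]; exists (p' + q'); rewrite mulrDl. Qed.

Lemma divides_mull l p q : divides l q -> divides l (p * q).
Proof. by move=> [q' ->]; exists (p * q'); rewrite mulrA. Qed.

Lemma divides_comp l p (g : n.-tuple {mpoly K[n]}) :
  divides l p -> divides (l \mPo g) (p \mPo g).
Proof. by move=> [q ->]; exists (q \mPo g); rewrite rmorphM. Qed.

Lemma divides_scale (c : K) l p : c != 0 -> divides (c *: l) p -> divides l p.
Proof. by move=> _ [q ->]; exists (c *: q); rewrite -scalerAl scalerAr. Qed.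

(** Modulo [l] the substitution fixes the variables, hence every polynomial. *)
Lemma divides_sub_comp l p (g : n.-tuple {mpoly K[n]}) :
  (forall i, divides l ('X_i - tnth g i)) -> divides l (p - (p \mPo g)).
Proof.
move=> Hg; elim/mpoly_ring_ind: p => [c|i|p q Hp Hq|p q Hp Hq].
- by rewrite comp_mpolyC subrr; exists 0; rewrite mul0r.
- by rewrite comp_mpolyXU -tnth_nth.
- by rewrite comp_mpolyD opprD addrACA; apply: dividesD.
- rewrite rmorphM /=.
  rewrite (_ : p * q - _ =
      q * (p - (p \mPo g)) + (p \mPo g) * (q - (q \mPo g))).
    by apply: dividesD; apply: divides_mull.
  by ring.
Qed.

Definition linform a : {mpoly K[n]} := \sum_i a i *: 'X_i.

Lemma comp_linform a (g : n.-tuple {mpoly K[n]}) :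
  linform a \mPo g = \sum_i a i *: tnth g i.
Proof.
rewrite /linform raddf_sum; apply: eq_bigr => i _.
by rewrite /= comp_mpolyZ comp_mpolyXU -tnth_nth.
Qed.

Lemma mcoeff_linform a j : (linform a)@_U_(j) = a j.
Proof.
rewrite /linform raddf_sum (bigD1 j) //= mcoeffZ mcoeffX eqxx mulr1.
rewrite big1 ?addr0 // => i /negbTE Hi; rewrite mcoeffZ mcoeffX.
by rewrite eq_mnm1 Hi mulr0.
Qed.

Lemma linform_homog a : linform a \is 1.-homog.
Proof. by apply: rpred_sum => i _; apply: rpredZ; rewrite dhomogX /= mdeg1. Qed.

(** Restriction to the hyperplane of [a], written as a substitution: [linform a = 0] is solved for
    the variable [i]. *)
Definition hyperplane_proj a i : n.-tuple {mpoly K[n]} :=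
  [tuple 'X_j - (if j == i then (a i)^-1 *: linform a else 0) | j < n].

Lemma linform_proj a b i :
  linform b \mPo hyperplane_proj a i = linform b - (b i / a i) *: linform a.
Proof.
rewrite comp_linform /=.
under eq_bigr => j _ do rewrite tnth_mktuple scalerBr.
rewrite sumrB; congr (_ - _); rewrite (bigD1 i) //= eqxx scalerA big1 ?addr0 //.
by move=> j /negbTE ->; rewrite scaler0.
Qed.

Lemma divides_linformP a i p : a i != 0 ->
  divides (linform a) p <-> p \mPo hyperplane_proj a i = 0.
Proof.
move=> Ha; split=> [[q ->]|H].
  by rewrite rmorphM /= linform_proj divff // scale1r subrr mulr0.
rewrite -[p]subr0 -{}H; apply: divides_sub_comp => j.
rewrite tnth_mktuple opprB addrC subrK; case: eqP => _.
  by exists (a i)^-1%:MP; rewrite mul_mpolyC.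
by exists 0; rewrite mul0r.
Qed.

(** The multiples of the form are the kernel of a ring morphism into a domain. *)
Lemma linform_prime a i p q : a i != 0 ->
  divides (linform a) (p * q) -> divides (linform a) p \/ divides (linform a) q.
Proof.
move=> Ha; rewrite !(divides_linformP _ Ha) rmorphM /= => /eqP.
by rewrite mulf_eq0 => /orP[/eqP|/eqP]; [left|right].
Qed.

(** Phrased by minors, without division, so that it can be tested by computation in Z[phi]. *)
Definition nonprop a b := exists i j, a i * b j != a j * b i.

Lemma nonprop_neq0 a b : nonprop a b -> exists i, b i != 0.
Proof.
move=> [i [j H]]; have [Hj|] := eqVneq (b j) 0; last by exists j.
have [Hi|] := eqVneq (b i) 0; last by exists i.
by rewrite Hj Hi !mulr0 eqxx in H.
Qed.

Lemma nonprop_linform a b : nonprop a b -> ~ divides (linform b) (linform a).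
Proof.
move=> Hab; have [k Hk] := nonprop_neq0 Hab.
rewrite (divides_linformP _ Hk) linform_proj => H.
have E j : a j = a k / b k * b j.
  by apply/eqP; rewrite -subr_eq0 -[X in X - _]mcoeff_linform
    -[X in _ * X]mcoeff_linform -mcoeffZ -mcoeffB H mcoeff0.
by have [i [j]] := Hab; rewrite (E i) (E j) mulrAC eqxx.
Qed.

(** The head form divides no form of the tail, so, being prime, it divides the cofactor left by the
    product of the tail. *)
Lemma prod_linforms_divides (s : seq ('I_n -> K)) p :
    (forall i j, (i < j < size s)%N ->
       nonprop (nth (fun=> 0) s j) (nth (fun=> 0) s i)) ->
    (forall i, (i < size s)%N -> divides (linform (nth (fun=> 0) s i)) p) ->
  divides (\prod_(a <- s) linform a) p.
Proof.
elim: s p => [|a s IHs] p Hs Hp; first by exists p; rewrite big_nil mulr1.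
have [q Eq] : divides (\prod_(b <- s) linform b) p.
  apply: IHs => [i j Hij|i Hi]; [exact: (Hs i.+1 j.+1)|exact: (Hp i.+1)].
(* Primality requires a nonzero coefficient; the zero form divides only 0, so in that case [p] is
   0. *)
have [a0|/forallPn[i Hi]] := boolP [forall i, a i == 0].
  have [q' E'] := Hp 0%N isT; exists 0; rewrite mul0r E' /= /linform.
  rewrite big1 ?mulr0 // => i _.
  by rewrite (eqP (forallP a0 i)) scale0r.
have [q' Eq'] : divides (linform a) q; last first.
  by exists q'; rewrite big_cons Eq Eq' mulrA.
have := Hp 0%N isT; rewrite Eq /= => /(linform_prime Hi)[//|].
rewrite (divides_linformP _ Hi) rmorph_prod /= => /eqP.
rewrite prodf_seq_eq0 => /(has_nthP (fun=> 0))[j Hj /= /eqP].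
rewrite -(divides_linformP _ Hi) => Hd.
by have /nonprop_linform[] := Hs 0%N j.+1 Hj.
Qed.

End LinearForms.

Lemma msize_dhomog (n : nat) (R : comNzRingType) (e : nat) (p : {mpoly R[n]}) :
  p != 0 -> p \is e.-homog -> msize p = e.+1.
Proof.
by move=> p0 /dhomogP H; rewrite -(mlead_deg p0) (H _ (mlead_supp p0)).
Qed.

(** Behaviour of the numerators in Cramer's rule under a change of variables with Jacobian [B]:
    since adj(AB) = adj(B) adj(A), they only pick up the factor [\det B]. *)
Lemma mulmx_adjM (R : idomainType) (n : nat) (v : 'rV[R]_n) (A B : 'M[R]_n) :
  \det (A *m B) != 0 -> v *m B *m \adj (A *m B) = \det B *: (v *m \adj A).
Proof.
move=> AB0; apply/rowP => k; apply: (mulfI AB0).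
have E : \det (A *m B) *: (v *m \adj A) = \det A *: (v *m B *m \adj (A *m B)).
  rewrite -mul_mx_scalar -mul_mx_adj !mulmxA -(mulmxA v _ A) mul_adj_mx.
  by rewrite mul_mx_scalar -!scalemxAl.
have : \det (A *m B) *: (v *m B *m \adj (A *m B)) =
       \det (A *m B) *: (\det B *: (v *m \adj A)).
  rewrite [RHS]scalerA mulrC -scalerA E scalerA det_mulmx.
  by rewrite [\det B * _]mulrC.
by move/rowP/(_ k); rewrite !mxE.
Qed.

Section WeightedDegree.

Variables (n : nat) (d : n.-tuple nat).

(** The variable [i] stands for an invariant of degree [d_i], so this weight becomes the ordinary
    degree after substitution. *)
Definition wdeg (m : 'X_{1..n}) : nat := (\sum_i tnth d i * m i)%N.

Lemma wdeg0 : wdeg 0%MM = 0%N.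
Proof. by apply: big1 => i _; rewrite mnm0E muln0. Qed.

Lemma wdegD : {morph wdeg : m1 m2 / (m1 + m2)%MM >-> (m1 + m2)%N}.
Proof.
move=> m1 m2; rewrite /wdeg -big_split /=; apply: eq_bigr => i _.
by rewrite mnmDE mulnDr.
Qed.

HB.instance Definition _ := isMeasure.Build n wdeg wdeg0 wdegD.

Lemma wdegU i : wdeg U_(i)%MM = tnth d i.
Proof.
rewrite /wdeg (bigD1 i) //= mnm1E eqxx muln1 big1 ?addn0 // => j /negbTE Hj.
by rewrite mnm1E eq_sym Hj muln0.
Qed.

End WeightedDegree.

(** * Independence and generation from the Jacobian determinant *)

Section JacobianCriterion.

Variables (n : nat) (K : numFieldType).
Variables (Z : n.-tuple {mpoly K[n]}).

Hypothesis jacZ : \det (jac Z) != 0.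

Lemma mulmx_adj_eq0 (v : 'rV[{mpoly K[n]}]_n) : v *m jac Z = 0 -> v = 0.
Proof.
move=> H; have : v *m jac Z *m \adj (jac Z) = 0 by rewrite H mul0mx.
rewrite -mulmxA mul_mx_adj mul_mx_scalar => /rowP E; apply/rowP => i.
by have /eqP := E i; rewrite !mxE mulf_eq0 (negbTE jacZ) => /eqP.
Qed.

Lemma mderiv_eq0 (p : {mpoly K[n]}) :
  (forall j, p^`M(j) = 0) -> p = (p@_0%MM)%:MP.
Proof.
move=> Hp; apply/mpolyP => m; rewrite mcoeffC.
have [-> |Hm] := eqVneq 0%MM m; first by rewrite mulr1.
have [j Hj] : exists j, m j != 0%N.
  apply/existsP; rewrite -negb_forall; apply: contra Hm => /forallP H.
  by apply/eqP/mnmP => j; rewrite mnm0E (eqP (H j)).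
have := mcoeff_mderiv j p (m - U_(j))%MM.
rewrite Hp mcoeff0 submK ?lep1mP // mulr0 => /esym/eqP.
by rewrite mulrn_eq0 /= => /eqP.
Qed.

(** By the chain rule the partial derivatives of a relation are relations again, of smaller size. By
    induction they vanish, which leaves a constant. *)
Lemma jac_independent (q : {mpoly K[n]}) : q \mPo Z = 0 -> q = 0.
Proof.
have [k] := ubnP (msize q); elim: k q => // k IHk q Hq H.
suff Eq : q = (q@_0%MM)%:MP.
  by move: H; rewrite Eq comp_mpolyC.
apply: mderiv_eq0 => j; have [->|q0] := eqVneq q 0; first exact: mderiv0.
apply: IHk.
  apply: (@leq_trans (msize q)); last by [].
  have [->|dq0] := eqVneq (q^`M(j)) 0.
    by rewrite msize0 lt0n msize_poly_eq0.
  rewrite -(mlead_deg dq0); have := mlead_supp dq0.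
  rewrite mcoeff_msupp mcoeff_mderiv => Hm.
  have /msize_mdeg_lt : (mlead q^`M(j) + U_(j))%MM \in msupp q.
    by rewrite mcoeff_msupp; apply: contraNneq Hm => ->; rewrite mul0rn.
  by rewrite mdegD mdeg1 addn1.
have /mulmx_adj_eq0/rowP/(_ j) : map_mx (comp_mpoly Z) (grad q) *m jac Z = 0.
  by rewrite -grad_comp H; apply/rowP => i; rewrite !mxE mderiv0.
by rewrite !mxE.
Qed.

Variables (G : seq (n.-tuple {mpoly K[n]})) (d : n.-tuple nat).
Variables (mirrors : seq ('I_n -> K)).

Hypothesis G_linear : forall g, g \in G -> forall i, tnth g i \is 1.-homog.
Hypothesis Z_invariant :
  forall g, g \in G -> forall i, tnth Z i \mPo g = tnth Z i.
Hypothesis d_gt0 : forall i, (0 < tnth d i)%N.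
Hypothesis Z_homog : forall i, tnth Z i \is (tnth d i).-homog.
Hypothesis mirrors_nonprop : forall i j, (i < j < size mirrors)%N ->
  nonprop (nth (fun=> 0) mirrors j) (nth (fun=> 0) mirrors i).
Hypothesis mirrors_size : size mirrors = (\sum_i (tnth d i).-1)%N.
Hypothesis mirrors_divide : forall p,
    (forall g, g \in G -> p = \det (jac g) * (p \mPo g)) ->
  forall i, (i < size mirrors)%N ->
    divides (linform (nth (fun=> 0) mirrors i)) p.

Definition invariant (p : {mpoly K[n]}) := forall g, g \in G -> p \mPo g = p.

Let J := \det (jac Z).

Lemma jac_invariant g :
  g \in G -> jac Z = map_mx (comp_mpoly g) (jac Z) *m jac g.
Proof.
move=> Hg; rewrite -jac_comp; congr jac; apply: eq_from_tnth => i.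
by rewrite tnth_mktuple Z_invariant.
Qed.

Lemma detJ_comp g : g \in G -> J = \det (jac g) * (J \mPo g).
Proof.
by move=> Hg; rewrite /J {1}(jac_invariant Hg) det_mulmx det_map_mx mulrC.
Qed.

(* The partial derivatives of [p] with respect to [Z], up to the factor [J]. *)
Let N (p : {mpoly K[n]}) := grad p *m \adj (jac Z).

Lemma N_comp p g j : invariant p -> g \in G ->
  N p 0 j = \det (jac g) * (N p 0 j \mPo g).
Proof.
move=> Hp Hg; set A := map_mx (comp_mpoly g) (jac Z).
set v := map_mx (comp_mpoly g) (grad p).
have EA : jac Z = A *m jac g := jac_invariant Hg.
have Ev : grad p = v *m jac g by rewrite -grad_comp Hp.
have A0 : \det (A *m jac g) != 0 by rewrite -EA.
have EN : N p 0 j \mPo g = (v *m \adj A) 0 j.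
  by rewrite /v /A -map_mx_adj -map_mxM [RHS]mxE.
have E := mulmx_adjM v A0; rewrite -Ev -EA in E.
by rewrite EN /N E mxE.
Qed.

(** The product L of the mirrors divides both [p] and J. As J and L have the same degree, J is a
    constant multiple of L, so J divides [p] too. *)
Lemma J_divides_antiinvariant p :
  (forall g, g \in G -> p = \det (jac g) * (p \mPo g)) -> divides J p.
Proof.
move=> Hp; have prodP := prod_linforms_divides mirrors_nonprop.
have [q Eq] := prodP _ (mirrors_divide Hp).
have [c Ec] := prodP _ (mirrors_divide (@detJ_comp)).
set L := \prod_(a <- mirrors) _ in Eq Ec.
have J0 : J != 0 by [].
have [c0 L0] : c != 0 /\ L != 0.
  by apply/norP; rewrite -mulf_eq0 -Ec.
suff [k k0 Ek] : exists2 k, k != 0 & c = k%:MP.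
  exists (k^-1 *: q); rewrite Ec Ek Eq mul_mpolyC -scalerAl -scalerAr scalerA.
  by rewrite mulVf // scale1r.
have HJ : J \is (size mirrors).-homog.
  rewrite mirrors_size; apply: det_dhomog => i j; rewrite mxE.
  exact: mderiv_dhomog.
have HL : L \is (size mirrors).-homog.
  rewrite -sum1_size; apply: prod_dhomog => a; exact: linform_homog.
(* As [msize] is the degree plus one, equal degrees force [c] to have [msize] 1. *)
have := msizeM c0 L0; rewrite -Ec (msize_dhomog J0 HJ) (msize_dhomog L0 HL).
rewrite addnS /= => E.
by apply/msize_poly1P; rewrite -(eqn_add2r (size mirrors)) -E add1n.
Qed.

Theorem invariant_expression (e : nat) (p : {mpoly K[n]}) :
    invariant p -> p \is e.-homog ->
  exists2 q : {mpoly K[n]}, q \is e.-homog for (wdeg d) & q \mPo Z = p.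
Proof.
have [k] := ubnP e; elim: k e p => // k IHk e p Hek Hp He.
have [e0|e_gt0] := posnP e.
  have Ep : p = (p@_0%MM)%:MP.
    have [->|p0] := eqVneq p 0; first by rewrite mcoeff0 mpolyC0.
    by apply: msize1_polyC; rewrite (msize_dhomog p0 He) e0.
  exists (p@_0%MM)%:MP; last by rewrite comp_mpolyC -Ep.
  by rewrite e0 -alg_mpolyC; apply: rpredZ; exact: dhomog1.
have /fin_all_exists[y Ey] i : exists y, N p 0 i = y * J.
  by apply: J_divides_antiinvariant => g; apply: N_comp.
(* [y i] is the partial derivative of [p] with respect to Z_i. It is a quotient of two
   anti-invariants, so the determinants cancel. *)
have y_inv i : invariant (y i).
  move=> g Hg; apply: (mulIf (jacZ : J != 0)).
  rewrite -Ey (N_comp i Hp Hg) Ey rmorphM /= {1}(detJ_comp Hg).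
  by rewrite mulrCA.
have dp j : p^`M(j) = \sum_i y i * (tnth Z i)^`M(j).
  apply: (mulfI (jacZ : J != 0)).
  transitivity ((N p *m jac Z) 0 j).
    by rewrite -mulmxA mul_adj_mx mul_mx_scalar !mxE.
  rewrite mxE mulr_sumr; apply: eq_bigr => i _.
  by rewrite Ey mxE mulrAC mulrC.
(* Euler's identity projected to degree [e]: the cofactors [y i] are not known to be homogeneous, so
   only their components of degree [e - d_i] are kept. *)
have Epe :
    e%:R *: p = \sum_i pihomog mdeg e (y i * ((tnth d i)%:R *: tnth Z i)).
  rewrite -linear_sum /= -[LHS](pihomog_dE (mf := mdeg) (d := e)) ?rpredZ //.
  congr (pihomog _ _ _); rewrite -(euler_dhomog He).
  transitivity (\sum_j \sum_i y i * (tnth Z i)^`M(j) * 'X_j).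
    by apply: eq_bigr => j _; rewrite dp mulr_suml.
  rewrite exchange_big; apply: eq_bigr => i _ /=.
  rewrite -(euler_dhomog (Z_homog i)) mulr_sumr; apply: eq_bigr => j _.
  by rewrite mulrA.
have /fin_all_exists2[q q_homog Eq] i :
    exists2 q : {mpoly K[n]}, q \is e.-homog for (wdeg d)
      & q \mPo Z = pihomog mdeg e (y i * ((tnth d i)%:R *: tnth Z i)).
  rewrite (pihomogM _ _ (dhomogZ _ (Z_homog i))).
  case: leqP => Hd; last by exists 0; rewrite ?dhomog0 ?comp_mpoly0.
  have [| |q Hq Eq] := IHk (e - tnth d i)%N _ _ _ (pihomogP mdeg _ (y i)).
  - by apply: leq_trans (_ : e <= k)%N => //; rewrite ltn_subrL d_gt0.
  - by move=> g Hg; rewrite -pihomog_comp ?y_inv //; apply: G_linear.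
  exists (q * ((tnth d i)%:R *: 'X_i)); last first.
    by rewrite rmorphM /= Eq comp_mpolyZ comp_mpolyXU -tnth_nth.
  rewrite -(subnK Hd) -wdegU; apply: dhomogM; first by rewrite wdegU.
  by apply: dhomogZ; rewrite dhomogX.
exists (e%:R^-1 *: \sum_i q i); first by rewrite rpredZ // rpred_sum.
rewrite comp_mpolyZ (raddf_sum (comp_mpoly Z)) /= (eq_bigr _ (fun i _ => Eq i)).
by rewrite -Epe scalerA mulVf ?scale1r // pnatr_eq0 -lt0n.
Qed.

End JacobianCriterion.

(** * The basic polynomials over an arbitrary commutative ring *)

Definition h2_of (R : comNzRingType) (x y z : R) : R :=
  x ^+ 2 + y ^+ 2 + z ^+ 2.

Definition h6_of (R : comNzRingType) (s x y z : R) : R :=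
  let e1 := x ^+ 2 + y ^+ 2 + z ^+ 2 in
  let e2 := x ^+ 2 * y ^+ 2 + x ^+ 2 * z ^+ 2 + y ^+ 2 * z ^+ 2 in
  let e3 := x ^+ 2 * y ^+ 2 * z ^+ 2 in
  let d := (x ^+ 2 - y ^+ 2) * (x ^+ 2 - z ^+ 2) * (y ^+ 2 - z ^+ 2) in
  - (11 * e3) + e1 * e2 + s * d.

Definition h10_of (R : comNzRingType) (s x y z : R) : R :=
  let e1 := x ^+ 2 + y ^+ 2 + z ^+ 2 in
  let e2 := x ^+ 2 * y ^+ 2 + x ^+ 2 * z ^+ 2 + y ^+ 2 * z ^+ 2 in
  let e3 := x ^+ 2 * y ^+ 2 * z ^+ 2 in
  let d := (x ^+ 2 - y ^+ 2) * (x ^+ 2 - z ^+ 2) * (y ^+ 2 - z ^+ 2) in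
  95 * e2 * e3 - 32 * e1 ^+ 2 * e3 - 5 * e1 * e2 ^+ 2 + 2 * e1 ^+ 3 * e2
  + 3 * s * (e2 * d).

(* 2 Z12, 2 Z20 and 15 Z30 have integral coefficients; [V] is [u4 ^+ 2]. *)
Definition Z12_num (R : comNzRingType) (h2 h6 h10 V : R) : R :=
  - 2 * (h10 * h2)
  + 3 * h6 ^+ 2
  + 2 * (11 * h10 - 2 * h2 ^+ 5) * V
  + 2 * (6 * h2 ^+ 4 - 33 * h2 * h6) * V ^+ 2
  - 2 * (14 * h2 ^+ 3 - 33 * h6) * V ^+ 3
  + 2 * 6 * h2 ^+ 2 * V ^+ 4
  - 2 * 2 * h2 * V ^+ 5.

Definition Z20_num (R : comNzRingType) (h2 h6 h10 V : R) : R :=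
  (2 * h10 ^+ 2 - 3 * h2 * h6 ^+ 3)
  + (8 * h10 * h2 ^+ 4 - 42 * h2 ^+ 3 * h6 ^+ 2 + 57 * h6 ^+ 3) * V
  - 2 * 2 * (38 * h10 * h2 ^+ 3 - 2 * h2 ^+ 8 + 57 * h10 * h6
      - 15 * h2 ^+ 5 * h6 - 84 * h2 ^+ 2 * h6 ^+ 2) * V ^+ 2
  + 2 * 2 * h2 * (148 * h10 * h2 - 10 * h2 ^+ 6 - 69 * h2 ^+ 3 * h6
      - 153 * h6 ^+ 2) * V ^+ 3
  - 2 * 2 * (232 * h10 * h2 - 22 * h2 ^+ 6 - 201 * h2 ^+ 3 * h6
      - 147 * h6 ^+ 2) * V ^+ 4
  + 2 * 2 * (90 * h10 - 22 * h2 ^+ 5 - 201 * h2 ^+ 2 * h6) * V ^+ 5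
  + 2 * 2 * h2 * (22 * h2 ^+ 3 + 69 * h6) * V ^+ 6
  - 2 * 10 * (2 * h2 ^+ 3 + 3 * h6) * V ^+ 7
  + 2 * 4 * h2 ^+ 2 * V ^+ 8.

Definition Z30_num (R : comNzRingType) (h2 h6 h10 V : R) : R :=
  (20 * h10 ^+ 3 - 45 * h10 * h2 * h6 ^+ 3 + 27 * h6 ^+ 5)
  + 15 * (8 * h10 ^+ 2 * h2 ^+ 4 - 42 * h10 * h2 ^+ 3 * h6 ^+ 2
      - 87 * h10 * h6 ^+ 3 - 6 * h2 ^+ 5 * h6 ^+ 3
      + 135 * h2 ^+ 2 * h6 ^+ 4) * V
  + 15 * (- (152 * h10 ^+ 2 * h2 ^+ 3) + 16 * h10 * h2 ^+ 8
      + 348 * h10 ^+ 2 * h6 + 60 * h10 * h2 ^+ 5 * h6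
      + 408 * h10 * h2 ^+ 2 * h6 ^+ 2 - 84 * h2 ^+ 7 * h6 ^+ 2
      + 84 * h2 ^+ 4 * h6 ^+ 3 - 909 * h2 * h6 ^+ 4) * V ^+ 2
  + 10 * (1752%:R * h10 ^+ 2 * h2 ^+ 2 - 516 * h10 * h2 ^+ 7 + 16 * h2 ^+ 12
      - 3258%:R * h10 * h2 ^+ 4 * h6 + 180 * h2 ^+ 9 * h6
      - 2862%:R * h10 * h2 * h6 ^+ 2 + 1998%:R * h2 ^+ 6 * h6 ^+ 2
      + 432 * h2 ^+ 3 * h6 ^+ 3 + 3591%:R * h6 ^+ 4) * V ^+ 3
  - 15 * 2 * (1616%:R * h10 ^+ 2 * h2 - 1072%:R * h10 * h2 ^+ 6
      + 40 * h2 ^+ 11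
      - 5454%:R * h10 * h2 ^+ 3 * h6 + 336 * h2 ^+ 8 * h6 + 453 * h10 * h6 ^+ 2
      + 3462%:R * h2 ^+ 5 * h6 ^+ 2 + 978 * h2 ^+ 2 * h6 ^+ 3) * V ^+ 4
  + 6 * (8100%:R * h10 ^+ 2 - 17900%:R * h10 * h2 ^+ 5 + 672 * h2 ^+ 10
      - 63330%:R * h10 * h2 ^+ 2 * h6 + 4020%:R * h2 ^+ 7 * h6
      + 49920%:R * h2 ^+ 4 * h6 ^+ 2 + 18375%:R * h2 * h6 ^+ 3) * V ^+ 5
  + 20 * (10662%:R * h10 * h2 ^+ 4 - 332 * h2 ^+ 9 + 17631%:R * h10 * h2 * h6
      - 936 * h2 ^+ 6 * h6 - 20547%:R * h2 ^+ 3 * h6 ^+ 2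
      - 4347%:R * h6 ^+ 3) * V ^+ 6
  - 15 * 4 * (4214%:R * h10 * h2 ^+ 3 - 68 * h2 ^+ 8 + 1905%:R * h10 * h6
      - 4647%:R * h2 ^+ 2 * h6 ^+ 2) * V ^+ 7
  + 15 * 4 * h2 * (2506%:R * h10 * h2 + 68 * h2 ^+ 6 + 312 * h2 ^+ 3 * h6
      - 1407%:R * h6 ^+ 2) * V ^+ 8
  - 40 * (1080%:R * h10 * h2 + 166 * h2 ^+ 6 + 603 * h2 ^+ 3 * h6
      - 405 * h6 ^+ 2) * V ^+ 9
  + 72 * (75 * h10 + 56 * h2 ^+ 5 + 140 * h2 ^+ 2 * h6) * V ^+ 10
  - 15 * 40 * h2 * (2 * h2 ^+ 3 + 3 * h6) * V ^+ 11
  + 160 * h2 ^+ 3 * V ^+ 12.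

(* 168 f *)
Definition f_num (R : comNzRingType) (s x y z t : R) : R :=
  t * (- (21 * h6_of s x y z) + 14 * h2_of x y z ^+ 2 * t ^+ 2
       - 14 * h2_of x y z * t ^+ 4 + 2 * t ^+ 6).

Section NumeratorMorphism.

Variables (R S : comNzRingType) (F : {rmorphism R -> S}).
Variables h2 h6 h10 V : R.

(** Substituting for the variables is a ring morphism, so composing an invariant only changes the
    arguments of these formulas. *)
Lemma rmorph_Z12_num :
  F (Z12_num h2 h6 h10 V) = Z12_num (F h2) (F h6) (F h10) (F V).
Proof. by rewrite /Z12_num; ring. Qed.

Lemma rmorph_Z20_num :
  F (Z20_num h2 h6 h10 V) = Z20_num (F h2) (F h6) (F h10) (F V).
Proof. by rewrite /Z20_num; ring. Qed.

Lemma rmorph_Z30_num :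
  F (Z30_num h2 h6 h10 V) = Z30_num (F h2) (F h6) (F h10) (F V).
Proof. by rewrite /Z30_num; ring. Qed.

Lemma rmorph_h2_of (x y z : R) : F (h2_of x y z) = h2_of (F x) (F y) (F z).
Proof. by rewrite /h2_of; ring. Qed.

Lemma rmorph_h6_of (s x y z : R) :
  F (h6_of s x y z) = h6_of (F s) (F x) (F y) (F z).
Proof. by rewrite /h6_of; ring. Qed.

Lemma rmorph_h10_of (s x y z : R) :
  F (h10_of s x y z) = h10_of (F s) (F x) (F y) (F z).
Proof. by rewrite /h10_of; ring. Qed.

Lemma rmorph_f_num (s x y z t : R) :
  F (f_num s x y z t) = f_num (F s) (F x) (F y) (F z) (F t).
Proof. by rewrite /f_num -rmorph_h6_of -rmorph_h2_of; ring. Qed.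

End NumeratorMorphism.

Section NumeratorIdentities.

Variable (R : comNzRingType).

(** [d] in [h6_of] and [h10_of] is alternating, hence preserved by cyclic permutations but not by
    transpositions. *)
Lemma h_cyclic (s x y z : R) :
  [/\ h2_of y z x = h2_of x y z, h6_of s y z x = h6_of s x y z
    & h10_of s y z x = h10_of s x y z].
Proof. by split; rewrite /h2_of /h6_of /h10_of; ring. Qed.

(** Homogeneity of degrees 2, 6, 10. Doubling the arguments clears the denominator 2 of the
    reflection. *)
Lemma h_double (s x y z : R) :
  [/\ h2_of (2 * x) (2 * y) (2 * z) = 4 * h2_of x y z,
      h6_of s (2 * x) (2 * y) (2 * z) = 64 * h6_of s x y z
    & h10_of s (2 * x) (2 * y) (2 * z) = 1024 * h10_of s x y z].
Proof. by split; rewrite /h2_of /h6_of /h10_of; ring. Qed.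

Lemma f_num_double (s x y z t : R) :
  128 * f_num s x y z t = f_num s (2 * x) (2 * y) (2 * z) (2 * t).
Proof. by rewrite /f_num /h6_of /h2_of; ring. Qed.

Section Reflection.

(* [g] is the golden ratio and [(x', y', z', t')] twice the image of
   [(x, y, z, t)] under the reflection in the root [(1, g, g - 1, 0) / 2]. *)
Variables (g x y z t : R).
Hypothesis Hg : g * g = g + 1.
Let s := 2 * g - 1.
Let L := x + g * y + (g - 1) * z.
Let x' := 2 * x - L.
Let y' := 2 * y - g * L.
Let z' := 2 * z - (g - 1) * L.

Lemma h_reflection :
  [/\ h2_of x' y' z' = 4 * h2_of x y z,
      h6_of s x' y' z' = 64 * h6_of s x y z
    & h10_of s x' y' z' = 1024 * h10_of s x y z].
Proof.
by split; rewrite /x' /y' /z' /L /s /h2_of /h6_of /h10_of; ring: Hg.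
Qed.

Let P1 := f_num s t z y x.
Let P2 := f_num s z t x y.
Let P3 := f_num s y x t z.
Let P4 := f_num s x y z t.
Let t' := 2 * t.
(* The conjugate root is [(1, 1 - g, - g, 0) / 2]. *)
Let M := P1 + (1 - g) * P2 + (- g) * P3.

(** On the P's the reflection acts through the conjugate root. The doubled arguments give 2^7 = 128;
    one factor 2 goes into the doubled conjugate reflection, leaving 64. *)
Lemma f_reflection :
  [/\ f_num s t' z' y' x' = 64 * (2 * P1 - M),
      f_num s z' t' x' y' = 64 * (2 * P2 - (1 - g) * M),
      f_num s y' x' t' z' = 64 * (2 * P3 - (- g) * M)
    & f_num s x' y' z' t' = 128 * P4].
Proof.
by split; rewrite /M /P1 /P2 /P3 /P4 /t' /x' /y' /z' /L /s /f_num /h2_of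
  /h6_of; ring: Hg.
Qed.

End Reflection.

Section Swap.

Variables (s x y z t : R).
Hypothesis Hs : s * s = 5.

Local Notation swap_invariant F :=
  (F (h2_of y x t) (h6_of s y x t) (h10_of s y x t) (z ^+ 2) =
   F (h2_of x y z) (h6_of s x y z) (h10_of s x y z) (t ^+ 2)).

(** The swap mixes [t] with the other variables and does not preserve [h2], [h6], [h10] one by one,
    so the numerators are compared as expanded polynomials. *)
Lemma Z12_num_swap : swap_invariant (Z12_num (R := R)).
Proof. by rewrite /Z12_num /h2_of /h6_of /h10_of; ring: Hs. Qed.

Lemma Z20_num_swap : swap_invariant (Z20_num (R := R)).
Proof. by rewrite /Z20_num /h2_of /h6_of /h10_of; ring: Hs. Qed.

Lemma Z30_num_swap : swap_invariant (Z30_num (R := R)).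
Proof. by rewrite /Z30_num /h2_of /h6_of /h10_of; ring: Hs. Qed.

End Swap.

End NumeratorIdentities.

(** * The invariants of H4 *)

Local Notation u1 := 'X_(@Ordinal 4 0 isT).
Local Notation u2 := 'X_(@Ordinal 4 1 isT).
Local Notation u3 := 'X_(@Ordinal 4 2 isT).
Local Notation u4 := 'X_(@Ordinal 4 3 isT).

Lemma drop_multiple (R : comNzRingType) (k w x y z : R) :
  k * w = 1 -> x = y + (1 - k * w) * z -> x = y.
Proof. by move=> -> ->; rewrite subrr mul0r addr0. Qed.

(* The goal is affine in [w], where [k * w = 1]; [ring] cannot use this equation
   itself, as it does not divide by the coefficient [k]. *)
Ltac clear_denominator Hw :=
  match type of Hw with ?k * ?w = 1 => match goal with |- ?L = w * ?N =>
    let L' := eval pattern w in L in match L' with ?F w =>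
      let E := fresh "E" in
      have E v : F v = v * N + (1 - k * v) * F 0; [ cbv beta; ring
      | refine (drop_multiple Hw (E w)) ] end
    end end.

Section Polynomials.

Variables (C : numClosedFieldType) (s : C).

(** Brings all fractions of a formula to one denominator [m], so that a single inverse occurs in
    it. *)
Lemma mpolyC_ratio n (a b k m : nat) : (0 < m)%N -> m = (b * k)%N ->
  (a%:R / b%:R : C)%:MP_[n] = (a * k)%:R * (m%:R^-1)%:MP.
Proof.
move=> m0 Em; rewrite -mpolyC_nat -mpolyCM; congr _%:MP.
have b0 : (b%:R : C) != 0.
  by rewrite pnatr_eq0 -lt0n; move: m0; rewrite Em muln_gt0 => /andP[].
have k0 : (k%:R : C) != 0.
  by rewrite pnatr_eq0 -lt0n; move: m0; rewrite Em muln_gt0 => /andP[].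
by rewrite Em !natrM invfM mulrACA divff // mulr1.
Qed.

Lemma mpolyC_natV n (k : nat) : (0 < k)%N -> k%:R * ((k%:R : C)^-1)%:MP_[n] = 1.
Proof.
by move=> k0; rewrite -mpolyC_nat -mpolyCM divff ?mpolyC1 // pnatr_eq0 -lt0n.
Qed.

Lemma Z12E : Z12 s = 2^-1 *: Z12_num (h2 s) (h6 s) (h10 s) (u4 ^+ 2).
Proof.
rewrite /Z12; cbv zeta; move: (h2 s) (h6 s) (h10 s) u4 => a b c d.
rewrite -!mul_mpolyC !(mpolyC_ratio 4 3 (b := 2) (k := 1) (m := 2)) //.
have := mpolyC_natV 4 (isT : (0 < 2)%N); move: (2^-1)%:MP => w Hw.
rewrite /Z12_num; clear_denominator Hw.
Qed.

Lemma Z20E : Z20 s = 2^-1 *: Z20_num (h2 s) (h6 s) (h10 s) (u4 ^+ 2).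
Proof.
rewrite /Z20; cbv zeta; move: (h2 s) (h6 s) (h10 s) u4 => a b c d.
rewrite -!mul_mpolyC !(mpolyC_ratio 4 1 (b := 2) (k := 1) (m := 2)) //.
have := mpolyC_natV 4 (isT : (0 < 2)%N); move: (2^-1)%:MP => w Hw.
rewrite /Z20_num; clear_denominator Hw.
Qed.

Lemma Z30E : Z30 s = 15^-1 *: Z30_num (h2 s) (h6 s) (h10 s) (u4 ^+ 2).
Proof.
(* Simplification ([/=]) must be avoided: it would unfold the large numerals. *)
rewrite /Z30; cbv zeta; move: (h2 s) (h6 s) (h10 s) u4 => a b c d.
rewrite -!mul_mpolyC (mpolyC_ratio 4 1 (b := 15) (k := 1) (m := 15)) //.
rewrite (mpolyC_ratio 4 2 (b := 3) (k := 5) (m := 15)) //.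
rewrite (mpolyC_ratio 4 2 (b := 5) (k := 3) (m := 15)) //.
rewrite (mpolyC_ratio 4 4 (b := 3) (k := 5) (m := 15)) //.
rewrite (mpolyC_ratio 4 8 (b := 3) (k := 5) (m := 15)) //.
rewrite (mpolyC_ratio 4 24 (b := 5) (k := 3) (m := 15)) //.
rewrite (mpolyC_ratio 4 32 (b := 3) (k := 5) (m := 15)) //.
have := mpolyC_natV 4 (isT : (0 < 15)%N); move: (15^-1)%:MP => w Hw.
rewrite /Z30_num; clear_denominator Hw.
Qed.

Lemma h2E : h2 s = h2_of u1 u2 u3.
Proof. by []. Qed.

Lemma h6E : h6 s = h6_of s%:MP u1 u2 u3.
Proof. by rewrite /h6 -mul_mpolyC. Qed.

Lemma h10E : h10 s = h10_of s%:MP u1 u2 u3.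
Proof. by rewrite /h10 -mul_mpolyC mpolyCM mpolyC_nat. Qed.

Section Composition.

Variable t : 4.-tuple {mpoly C[4]}.

Lemma comp_h2 : h2 s \mPo t = h2_of t`_0 t`_1 t`_2.
Proof. by rewrite h2E rmorph_h2_of /= !comp_mpolyXU. Qed.

Lemma comp_h6 : h6 s \mPo t = h6_of s%:MP t`_0 t`_1 t`_2.
Proof. by rewrite h6E rmorph_h6_of /= comp_mpolyC !comp_mpolyXU. Qed.

Lemma comp_h10 : h10 s \mPo t = h10_of s%:MP t`_0 t`_1 t`_2.
Proof. by rewrite h10E rmorph_h10_of /= comp_mpolyC !comp_mpolyXU. Qed.

Lemma comp_Z2 : Z2 s \mPo t = (h2 s \mPo t) + t`_3 ^+ 2.
Proof. by rewrite /Z2 comp_mpolyD rmorphXn /= comp_mpolyXU. Qed.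

Lemma comp_Z12 : Z12 s \mPo t =
  2^-1 *: Z12_num (h2 s \mPo t) (h6 s \mPo t) (h10 s \mPo t) (t`_3 ^+ 2).
Proof. by rewrite Z12E comp_mpolyZ rmorph_Z12_num rmorphXn /= comp_mpolyXU. Qed.

Lemma comp_Z20 : Z20 s \mPo t =
  2^-1 *: Z20_num (h2 s \mPo t) (h6 s \mPo t) (h10 s \mPo t) (t`_3 ^+ 2).
Proof. by rewrite Z20E comp_mpolyZ rmorph_Z20_num rmorphXn /= comp_mpolyXU. Qed.

Lemma comp_Z30 : Z30 s \mPo t =
  15^-1 *: Z30_num (h2 s \mPo t) (h6 s \mPo t) (h10 s \mPo t) (t`_3 ^+ 2).
Proof. by rewrite Z30E comp_mpolyZ rmorph_Z30_num rmorphXn /= comp_mpolyXU. Qed.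

End Composition.

(** Keeping [s] free covers the Z's at [sqrtC 5] and the starred ones at [- sqrtC 5]. *)
Definition Z_at : 4.-tuple {mpoly C[4]} := [tuple Z2 s; Z12 s; Z20 s; Z30 s].

Definition phi : C := (1 + s) / 2.

Definition flip_map : 4.-tuple {mpoly C[4]} := [tuple u1; u2; u3; - u4].
Definition cycle_map : 4.-tuple {mpoly C[4]} := [tuple u2; u3; u1; u4].
Definition swap_map : 4.-tuple {mpoly C[4]} := [tuple u2; u1; u4; u3].

(* The reflection in the root (1, phi, phi - 1, 0) / 2. *)
Definition reflection_map : 4.-tuple {mpoly C[4]} :=
  let l := 2^-1 *: (u1 + phi *: u2 + (phi - 1) *: u3) in
  [tuple u1 - l; u2 - phi *: l; u3 - (phi - 1) *: l; u4].

(** The flip supplies the mirror [u4 = 0]; the four maps together carry it to all sixty. *)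
Definition H4_gens := [:: flip_map; cycle_map; swap_map; reflection_map].

Lemma scale2_reflection :
  let g := phi%:MP in let l := u1 + g * u2 + (g - 1) * u3 in
  [/\ 2 * reflection_map`_0 = 2 * u1 - l, 2 * reflection_map`_1 = 2 * u2 - g * l
    & 2 * reflection_map`_2 = 2 * u3 - (g - 1) * l].
Proof.
rewrite /reflection_map /= -!mul_mpolyC mpolyCB mpolyC1.
have E (x y : {mpoly C[4]}) : 2 * (x - y * ((2^-1)%:MP
   * (u1 + phi%:MP * u2 + (phi%:MP - 1) * u3))) =
   2 * x - y * (u1 + phi%:MP * u2 + (phi%:MP - 1) * u3).
  rewrite mulrBr; congr (_ - _); rewrite mulrCA (mulrA 2).
  by rewrite mpolyC_natV // mul1r.
by split; rewrite ?E // -[X in _ - X]mul1r E mul1r.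
Qed.

Hypothesis Hs : s * s = 5.

Lemma double_phi : 2 * phi = 1 + s.
Proof. by rewrite /phi mulrC divfK ?pnatr_eq0. Qed.

Lemma phi_sqr : phi * phi = phi + 1.
Proof.
apply: (@mulfI _ (2 * 2)); first by rewrite mulf_neq0 ?pnatr_eq0.
have -> : 2 * 2 * (phi + 1) = 2 * (2 * phi) + 4 by ring.
by rewrite mulrACA double_phi; ring: Hs.
Qed.

Lemma mpoly_phi_sqr : phi%:MP_[4] * phi%:MP = phi%:MP + 1.
Proof. by rewrite -mpolyCM phi_sqr mpolyCD mpolyC1. Qed.

Lemma mpolyC_sE : s%:MP_[4] = 2 * phi%:MP - 1.
Proof.
by rewrite -mpolyC_nat -mpolyCM -mpolyC1 -mpolyCB double_phi addrC addKr.
Qed.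

Lemma mpoly_nat_neq0 (k : nat) : (0 < k)%N -> (k%:R : {mpoly C[4]}) != 0.
Proof. by move=> k0; rewrite -mpolyC_nat mpolyC_eq0 pnatr_eq0 -lt0n. Qed.

(** A sufficient condition for fixing the Z's, which involve [u4] only through its square. It holds
    for every generator but the swap. *)
Definition fixes_h (g : 4.-tuple {mpoly C[4]}) :=
  [/\ h2 s \mPo g = h2 s, h6 s \mPo g = h6 s, h10 s \mPo g = h10 s
    & g`_3 ^+ 2 = u4 ^+ 2].

Lemma fixes_h_flip : fixes_h flip_map.
Proof. by rewrite /fixes_h comp_h2 comp_h6 comp_h10 h2E h6E h10E /= sqrrN. Qed.

Lemma fixes_h_cycle : fixes_h cycle_map.
Proof.
rewrite /fixes_h comp_h2 comp_h6 comp_h10 h2E h6E h10E /=.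
by have [-> -> ->] := h_cyclic s%:MP (u1 : {mpoly C[4]}) u2 u3.
Qed.

Lemma fixes_h_reflection : fixes_h reflection_map.
Proof.
rewrite /fixes_h comp_h2 comp_h6 comp_h10 h2E h6E h10E.
have [E0 E1 E2] := scale2_reflection.
have [F0 F1 F2] := h_reflection u1 u2 u3 mpoly_phi_sqr.
rewrite -mpolyC_sE -E0 -E1 -E2 in F0 F1 F2.
have [D0 D1 D2] :=
  h_double s%:MP reflection_map`_0 reflection_map`_1 reflection_map`_2.
split=> //.
- by apply: (mulfI (mpoly_nat_neq0 (isT : 0 < 4)%N)); rewrite -F0 -D0.
- by apply: (mulfI (mpoly_nat_neq0 (isT : 0 < 64)%N)); rewrite -F1 -D1.
- by apply: (mulfI (mpoly_nat_neq0 (isT : 0 < 1024)%N)); rewrite -F2 -D2.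
Qed.

Lemma Z_at_fixed g : fixes_h g -> forall i, tnth Z_at i \mPo g = tnth Z_at i.
Proof.
move=> [E2 E6 E10 E4]; case=> [[|[|[|[|//]]]]] Hi; rewrite (tnth_nth 0) /=.
- by rewrite comp_Z2 E2 E4.
- by rewrite comp_Z12 E2 E6 E10 E4 -Z12E.
- by rewrite comp_Z20 E2 E6 E10 E4 -Z20E.
- by rewrite comp_Z30 E2 E6 E10 E4 -Z30E.
Qed.

Lemma Z_at_swap i : tnth Z_at i \mPo swap_map = tnth Z_at i.
Proof.
have Hs' : s%:MP_[4] * s%:MP = 5 by rewrite -mpolyCM Hs mpolyC_nat.
case: i => [[|[|[|[|//]]]]] Hi; rewrite (tnth_nth 0) /=.
- by rewrite comp_Z2 comp_h2 /Z2 h2E /h2_of /=; ring.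
- rewrite comp_Z12 Z12E comp_h2 comp_h6 comp_h10 h2E h6E h10E /=.
  by rewrite (Z12_num_swap _ _ _ _ Hs').
- rewrite comp_Z20 Z20E comp_h2 comp_h6 comp_h10 h2E h6E h10E /=.
  by rewrite (Z20_num_swap _ _ _ _ Hs').
- rewrite comp_Z30 Z30E comp_h2 comp_h6 comp_h10 h2E h6E h10E /=.
  by rewrite (Z30_num_swap _ _ _ _ Hs').
Qed.

Lemma Z_at_invariant g :
  g \in H4_gens -> forall i, tnth Z_at i \mPo g = tnth Z_at i.
Proof.
rewrite !inE => /or4P[] /eqP ->; last exact/Z_at_fixed/fixes_h_reflection.
- exact/Z_at_fixed/fixes_h_flip.
- exact/Z_at_fixed/fixes_h_cycle.
- exact: Z_at_swap.
Qed.

End Polynomials.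

(** * Equivariance of the map P *)

Section Equivariance.

Variable C : numClosedFieldType.
Let s : C := sqrtC 5.

Lemma fE : f C = (168^-1)%:MP * f_num s%:MP u1 u2 u3 u4.
Proof. by rewrite mul_mpolyC /f -scalerAl h2E h6E div1r. Qed.

Lemma comp_f (t : 4.-tuple {mpoly C[4]}) :
  f C \mPo t = (168^-1)%:MP * f_num s%:MP t`_0 t`_1 t`_2 t`_3.
Proof.
by rewrite fE rmorphM rmorph_f_num /= !comp_mpolyC !comp_mpolyXU.
Qed.

Lemma eq_mull (c p q : {mpoly C[4]}) : p = q -> c * p = c * q.
Proof. by move->. Qed.

Lemma tcompE (i : nat) (t g : 4.-tuple {mpoly C[4]}) :
  (i < 4)%N -> (tcomp t g)`_i = t`_i \mPo g.
Proof. by move=> Hi; rewrite -!(tnth_nth 0 _ (Ordinal Hi)) tnth_mktuple. Qed.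

Lemma eq_4tuple (t t' : 4.-tuple {mpoly C[4]}) :
  t`_0 = t'`_0 -> t`_1 = t'`_1 -> t`_2 = t'`_2 -> t`_3 = t'`_3 -> t = t'.
Proof.
move=> E0 E1 E2 E3; apply: eq_from_tnth.
by case=> [[|[|[|[|//]]]]] Hi; rewrite !(tnth_nth 0).
Qed.

Lemma eq_tcomp (t g t' g' : 4.-tuple {mpoly C[4]}) :
    t`_0 \mPo g = (t'`_0 \mPo g') -> t`_1 \mPo g = (t'`_1 \mPo g') ->
    t`_2 \mPo g = (t'`_2 \mPo g') -> t`_3 \mPo g = (t'`_3 \mPo g') ->
  tcomp t g = tcomp t' g'.
Proof.
move=> E0 E1 E2 E3; apply: eq_4tuple.
- exact: etrans (@tcompE 0 t g isT) (etrans E0 (esym (@tcompE 0 t' g' isT))).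
- exact: etrans (@tcompE 1 t g isT) (etrans E1 (esym (@tcompE 1 t' g' isT))).
- exact: etrans (@tcompE 2 t g isT) (etrans E2 (esym (@tcompE 2 t' g' isT))).
- exact: etrans (@tcompE 3 t g isT) (etrans E3 (esym (@tcompE 3 t' g' isT))).
Qed.

Lemma P_nth : [/\ (P C)`_0 = (168^-1)%:MP * f_num s%:MP u4 u3 u2 u1,
  (P C)`_1 = (168^-1)%:MP * f_num s%:MP u3 u4 u1 u2,
  (P C)`_2 = (168^-1)%:MP * f_num s%:MP u2 u1 u4 u3
  & (P C)`_3 = (168^-1)%:MP * f_num s%:MP u1 u2 u3 u4].
Proof. by split; exact: comp_f. Qed.

Lemma comp_P (g : 4.-tuple {mpoly C[4]}) :
  [/\ (P C)`_0 \mPo g = (168^-1)%:MP * f_num s%:MP g`_3 g`_2 g`_1 g`_0,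
  (P C)`_1 \mPo g = (168^-1)%:MP * f_num s%:MP g`_2 g`_3 g`_0 g`_1,
  (P C)`_2 \mPo g = (168^-1)%:MP * f_num s%:MP g`_1 g`_0 g`_3 g`_2
  & (P C)`_3 \mPo g = (168^-1)%:MP * f_num s%:MP g`_0 g`_1 g`_2 g`_3].
Proof.
have [-> -> -> ->] := P_nth.
by split; rewrite rmorphM rmorph_f_num /= !comp_mpolyC !comp_mpolyXU.
Qed.

Lemma P_flip : tcomp (P C) (flip_map C) = tcomp (flip_map C) (P C).
Proof.
move: (P C) P_nth (comp_P (flip_map C)) => p [E0 E1 E2 E3] [F0 F1 F2 F3].
apply: eq_tcomp.
- rewrite F0 /= comp_mpolyXU E0; apply: eq_mull.
  by rewrite /f_num /h6_of /h2_of; ring.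
- rewrite F1 /= comp_mpolyXU E1; apply: eq_mull.
  by rewrite /f_num /h6_of /h2_of; ring.
- rewrite F2 /= comp_mpolyXU E2; apply: eq_mull.
  by rewrite /f_num /h6_of /h2_of; ring.
- rewrite F3 /= comp_mpolyN comp_mpolyXU E3 -mulrN; apply: eq_mull.
  by rewrite /f_num /h6_of /h2_of; ring.
Qed.

(** The arguments of the four P's are the images of (u1, u2, u3, u4) under the Klein four-group. A
    3-cycle normalizes that group, so it permutes the P's up to a cyclic shift of the first three
    arguments of [f], which [f] ignores. *)
Lemma P_cycle : tcomp (P C) (cycle_map C) = tcomp (cycle_map C) (P C).
Proof.
move: (P C) P_nth (comp_P (cycle_map C)) => p [E0 E1 E2 E3] [F0 F1 F2 F3].
apply: eq_tcomp.
- rewrite F0 /= comp_mpolyXU E1; apply: eq_mull.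
  by rewrite /f_num /h6_of /h2_of; ring.
- rewrite F1 /= comp_mpolyXU E2; apply: eq_mull.
  by rewrite /f_num /h6_of /h2_of; ring.
- rewrite F2 /= comp_mpolyXU E0; apply: eq_mull.
  by rewrite /f_num /h6_of /h2_of; ring.
- rewrite F3 /= comp_mpolyXU E3; apply: eq_mull.
  by rewrite /f_num /h6_of /h2_of; ring.
Qed.

Lemma P_swap : tcomp (P C) (swap_map C) = tcomp (swap_map C) (P C).
Proof.
move: (P C) P_nth (comp_P (swap_map C)) => p [E0 E1 E2 E3] [F0 F1 F2 F3].
apply: eq_tcomp.
- by rewrite F0 /= comp_mpolyXU E1; apply: eq_mull.
- by rewrite F1 /= comp_mpolyXU E0; apply: eq_mull.
- by rewrite F2 /= comp_mpolyXU E3; apply: eq_mull.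
- by rewrite F3 /= comp_mpolyXU E2; apply: eq_mull.
Qed.

Lemma comp_reflection (r : C) (t : 4.-tuple {mpoly C[4]}) :
  let g := (phi r)%:MP in let l := t`_0 + g * t`_1 + (g - 1) * t`_2 in
  [/\ 2 * ((reflection_map r)`_0 \mPo t) = 2 * t`_0 - l,
      2 * ((reflection_map r)`_1 \mPo t) = 2 * t`_1 - g * l,
      2 * ((reflection_map r)`_2 \mPo t) = 2 * t`_2 - (g - 1) * l
    & (reflection_map r)`_3 \mPo t = t`_3].
Proof.
have compl c : (u1 + c%:MP * u2 + (c%:MP - 1) * u3) \mPo t =
    t`_0 + c%:MP * t`_1 + (c%:MP - 1) * t`_2.
  by rewrite !comp_mpolyD !rmorphM /= comp_mpolyB comp_mpolyC comp_mpoly1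
    !comp_mpolyXU.
have comp2 (p : {mpoly C[4]}) : 2 * (p \mPo t) = (2 * p) \mPo t.
  by rewrite rmorphM rmorph_nat.
move: (phi r) (scale2_reflection r) => c [E0 E1 E2].
split; last by rewrite comp_mpolyXU.
- by rewrite comp2 E0 comp_mpolyB compl rmorphM rmorph_nat /= comp_mpolyXU.
- rewrite comp2 E1 comp_mpolyB !rmorphM rmorph_nat /= compl comp_mpolyC.
  by rewrite comp_mpolyXU.
- rewrite comp2 E2 comp_mpolyB !rmorphM rmorph_nat /= compl comp_mpolyB.
  by rewrite comp_mpolyC comp_mpoly1 comp_mpolyXU.
Qed.

Lemma sqrt5_sqr : s * s = 5.
Proof. by rewrite -expr2 sqrtCK. Qed.

Lemma phi_opp : (phi (- s))%:MP_[4] = 1 - (phi s)%:MP.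
Proof.
rewrite -mpolyC1 -mpolyCB; congr _%:MP; rewrite /phi mulrDl [in RHS]mulrDl.
rewrite opprD addrA mulNr; congr (_ - _).
by rewrite -[X in X - _](@divff _ 2) ?pnatr_eq0 // -mulrBl -[2]/(1 + 1) addrK.
Qed.

Lemma P_reflection :
  tcomp (P C) (reflection_map s) = tcomp (reflection_map (- s)) (P C).
Proof.
have [D0 D1 D2] := scale2_reflection s.
have := f_reflection (u1 : {mpoly C[4]}) u2 u3 u4 (mpoly_phi_sqr sqrt5_sqr).
rewrite -(mpolyC_sE s) -D0 -D1 -D2 -[2 * u4]/(2 * (reflection_map s)`_3).
rewrite -!f_num_double.
move: (reflection_map s) (reflection_map (- s)) (comp_P (reflection_map s))
  (comp_reflection (- s) (P C)) => r r'; rewrite phi_opp.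
move: (P C) P_nth => p [E0 E1 E2 E3].
move=> [F0 F1 F2 F3] [G0 G1 G2 G3] [H0 H1 H2 H3].
rewrite E0 E1 E2 in G0 G1 G2; rewrite E3 in G3.
have n128 := mpoly_nat_neq0 C (isT : (0 < 128)%N).
(* Matches the factors: 128 from [f_num_double], 64 from [f_reflection], and the remaining 2 from
   [comp_reflection]. *)
have aux (c : C) (x y w : {mpoly C[4]}) :
    128 * x = 64 * w -> 2 * y = c%:MP * w -> 128 * (c%:MP * x) = 128 * y.
  move=> Hx Hy; rewrite mulrCA Hx mulrCA -Hy; ring.
have aux' (x y z : {mpoly C[4]}) :
    128 * y = 128 * z -> 128 * (x * y) = 128 * (x * z).
  by move=> H; rewrite mulrCA H mulrCA.
apply: eq_tcomp; apply: (mulfI n128).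
- rewrite F0; apply: (aux _ _ _ _ H0); apply: etrans G0 _.
  by move: (f_num _ _ _ _ _) (f_num _ _ _ _ _) => x y; ring.
- rewrite F1; apply: (aux _ _ _ _ H1); apply: etrans G1 _.
  by move: (f_num _ _ _ _ _) (f_num _ _ _ _ _) => x y; ring.
- rewrite F2; apply: (aux _ _ _ _ H2); apply: etrans G2 _.
  by move: (f_num _ _ _ _ _) (f_num _ _ _ _ _) => x y; ring.
- rewrite F3; apply: etrans (aux' _ _ _ H3) _; apply: eq_mull; exact: esym G3.
Qed.

Lemma P_equivariant g : g \in H4_gens s ->
  exists2 g', g' \in H4_gens (- s) & tcomp (P C) g = tcomp g' (P C).
Proof.
rewrite !inE => /or4P[] /eqP ->.
- by exists (flip_map C); rewrite ?P_flip // !inE eqxx.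
- by exists (cycle_map C); rewrite ?P_cycle // !inE eqxx ?orbT.
- by exists (swap_map C); rewrite ?P_swap // !inE eqxx ?orbT.
- by exists (reflection_map (- s)); rewrite ?P_reflection // !inE eqxx ?orbT.
Qed.

End Equivariance.

(** * Degrees of the concrete polynomials *)

Section HomogeneityLemmas.

Variables (n : nat) (R : comNzRingType).
Implicit Types (p q : {mpoly R[n]}).

Lemma homog_cast e d p : p \is e.-homog -> e = d -> p \is d.-homog.
Proof. by move=> Hp <-. Qed.

Lemma homog_add e e1 p q :
  p \is e.-homog -> q \is e1.-homog -> e = e1 -> p + q \is e.-homog.
Proof. by move=> Hp Hq E; rewrite dhomogD // E. Qed.

Lemma homog_opp e p : p \is e.-homog -> - p \is e.-homog.
Proof. by rewrite dhomogN. Qed.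

Lemma homog_nat k : (k%:R : {mpoly R[n]}) \is 0.-homog.
Proof. by rewrite rpredMn // dhomog1. Qed.

Lemma homog_var i : ('X_i : {mpoly R[n]}) \is 1.-homog.
Proof. by rewrite dhomogX /= mdeg1. Qed.

End HomogeneityLemmas.

(** Reads the degree off the shape of the expression; that the summands have equal degrees is
    decided by computation. *)
Ltac homog_rec :=
  lazymatch goal with
  | |- is_true (in_mem (_ + _) _) =>
    refine (homog_add _ _ _); [homog_rec | homog_rec | reflexivity]
  | |- is_true (in_mem (- _) _) => refine (homog_opp _); homog_rec
  | |- is_true (in_mem (_ * _) _) => refine (dhomogM _ _); homog_rec
  | |- is_true (in_mem (_ *: _) _) => refine (dhomogZ _ _); homog_rec
  | |- is_true (in_mem (_ ^+ _) _) => refine (dhomogMn _ _); homog_rec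
  | |- is_true (in_mem (_%:R) _) => exact: homog_nat
  | |- is_true (in_mem 'X_(_) _) => exact: homog_var
  | |- _ => eassumption
  end.
Ltac solve_dhomog := refine (homog_cast _ _); [homog_rec | reflexivity].

Definition degs : 4.-tuple nat := [tuple 2; 12; 20; 30]%N.

Section Homogeneity.

Variables (C : numClosedFieldType) (s : C).

Lemma h2_homog : h2 s \is 2.-homog.
Proof. rewrite /h2 /eps1; solve_dhomog. Qed.

Lemma h6_homog : h6 s \is 6.-homog.
Proof. rewrite /h6 /eps1 /eps2 /eps3 /delta; solve_dhomog. Qed.

Lemma h10_homog : h10 s \is 10.-homog.
Proof. rewrite /h10 /eps1 /eps2 /eps3 /delta; solve_dhomog. Qed.

Lemma Z_at_homog i : tnth (Z_at s) i \is (tnth degs i).-homog.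
Proof.
have H2 := h2_homog; have H6 := h6_homog; have H10 := h10_homog.
move: i; case=> [[|[|[|[|//]]]]] Hi; rewrite (tnth_nth 0) (tnth_nth 0%N).
- rewrite /= /Z2; cbv zeta; move: (h2 s) H2 => a H2; solve_dhomog.
- rewrite /= /Z12; cbv zeta.
  move: (h2 s) (h6 s) (h10 s) H2 H6 H10 => a b c H2 H6 H10; solve_dhomog.
- rewrite /= /Z20; cbv zeta.
  move: (h2 s) (h6 s) (h10 s) H2 H6 H10 => a b c H2 H6 H10; solve_dhomog.
- rewrite /= /Z30; cbv zeta.
  move: (h2 s) (h6 s) (h10 s) H2 H6 H10 => a b c H2 H6 H10; solve_dhomog.
Qed.

End Homogeneity.

Section HomogeneityP.

Variable C : numClosedFieldType.

Lemma f_homog : f C \is 7.-homog.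
Proof.
have H2 := h2_homog (sqrtC 5 : C); have H6 := h6_homog (sqrtC 5 : C).
rewrite /f; cbv zeta; solve_dhomog.
Qed.

Lemma P_homog i : tnth (P C) i \is 7.-homog.
Proof.
have H (t : 4.-tuple {mpoly C[4]}) :
    (forall j, tnth t j \is 1.-homog) -> f C \mPo t \is 7.-homog.
  move=> Ht; apply: (homog_cast (comp_dhomog (e := 1%N) _ f_homog)) => // j.
  by rewrite /= mdeg1 Ht.
move: i; case=> [[|[|[|[|//]]]]] Hi; rewrite (tnth_nth 0); apply: H;
  by case=> [[|[|[|[|//]]]]] Hj; rewrite (tnth_nth 0) homog_var.
Qed.

Lemma Y_homog (s : C) i :
  tnth (Z_at s) i \mPo P C \is (tnth degs i * 7)%N.-homog.
Proof.
apply: comp_dhomog (Z_at_homog s i) => j; rewrite /= mdeg1; exact: P_homog.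
Qed.

End HomogeneityP.

(** * Nonvanishing of the Jacobian *)

Section PointDerivation.

Variables (R S : comNzRingType).
Variables (e : {rmorphism R -> S}) (d : {additive R -> S}).
(** Leibniz rule for a derivation at the point [e]; it yields derivatives at that point without
    expanding the polynomials. *)
Hypothesis dM : forall p q, d (p * q) = d p * e q + e p * d q.

Lemma pderiv1 : d 1 = 0.
Proof.
have := dM 1 1; rewrite rmorph1 !mulr1 mul1r => E.
by apply: (addrI (d 1)); rewrite addr0 -E.
Qed.

Lemma pderiv_nat k : d k%:R = 0.
Proof. by rewrite raddfMn /= pderiv1 mul0rn. Qed.

Lemma pderivXn p k : d (p ^+ k.+1) = k.+1%:R * e p ^+ k * d p.
Proof.
elim: k => [|k IHk]; first by rewrite expr1 mul1r mul1r.
by rewrite exprS dM IHk rmorphXn /= [RHS]mulrC exprS; ring.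
Qed.

Let pderivE := (raddfB d, raddfD d, raddfN d, dM, pderivXn, pderiv_nat).

Section Numerators.

Variables h2 h6 h10 V : R.
Hypotheses (e2 : e h2 = 0) (e6 : e h6 = 1) (e10 : e h10 = 1) (eV : e V = 0).

Lemma pderivMV p : d (p * V) = e p * d V.
Proof. by rewrite dM eV mulr0 add0r. Qed.

(** The point has V = 0, so only the terms of degree at most 1 in [V] survive; this and h2 = 0 leave
    very little of the numerators. *)
Lemma pderivMVX p k : d (p * V ^+ k.+2) = 0.
Proof.
by rewrite dM rmorphXn pderivXn /= eV !expr0n /= !(mulr0, mul0r) addr0.
Qed.

Let rmorphE := (rmorphB e, rmorphD e, rmorphN e, rmorphM e, rmorphXn e,
  rmorph_nat e).

Lemma pderiv_Z12_num : d (Z12_num h2 h6 h10 V) =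
  - 2 * d h2 + 6 * d h6 + 22 * d V.
Proof.
rewrite /Z12_num !(raddfB d, raddfD d) !pderivMVX pderivMV !pderivE.
by rewrite !rmorphE /= e2 e6 e10; ring.
Qed.

Lemma pderiv_Z20_num : d (Z20_num h2 h6 h10 V) =
  - 3 * d h2 + 4 * d h10 + 57 * d V.
Proof.
rewrite /Z20_num !(raddfB d, raddfD d) !pderivMVX pderivMV !pderivE.
by rewrite !rmorphE /= e2 e6 e10; ring.
Qed.

Lemma pderiv_Z30_num : d (Z30_num h2 h6 h10 V) =
  - 45 * d h2 + 135 * d h6 + 60 * d h10 - 1305 * d V.
Proof.
rewrite /Z30_num !(raddfB d, raddfD d) !pderivMVX pderivMV !pderivE.
by rewrite !rmorphE /= e2 e6 e10; ring.
Qed.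

End Numerators.

Section Basic.

Let rmorphE := (rmorphB e, rmorphD e, rmorphN e, rmorphM e, rmorphXn e,
  rmorph_nat e).

Variables s x y z : R.
Hypotheses (ds : d s = 0) (ex : e x = 1) (ey : e y = 1) (ez : e z = 2).

Lemma pderiv_h2_of : d (h2_of x y z) = 2 * d x + 2 * d y + 4 * d z.
Proof. by rewrite /h2_of !pderivE ex ey ez; ring. Qed.

Lemma pderiv_h6_of : d (h6_of s x y z) =
  (- 10 + 18 * e s) * d x + (- 10 - 18 * e s) * d y + 40 * d z.
Proof.
rewrite /h6_of !pderivE.
by rewrite !rmorphE /= ds ex ey ez; ring.
Qed.

Lemma pderiv_h10_of : d (h10_of s x y z) =
  (350 + 486 * e s) * d x + (350 - 486 * e s) * d y + 1000 * d z.
Proof.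
rewrite /h10_of !pderivE.
by rewrite !rmorphE /= ds ex ey ez; ring.
Qed.

End Basic.

End PointDerivation.

Section JacobianNonzero.

Variables (C : numClosedFieldType) (s : C).

Definition basic_h : 4.-tuple {mpoly C[4]} :=
  [tuple h2 s; h6 s; h10 s; u4 ^+ 2].

(* Here the variables stand for [h2], [h6], [h10] and [u4 ^+ 2]. *)
Definition Z_of_h : 4.-tuple {mpoly C[4]} :=
  [tuple u1 + u4; 2^-1 *: Z12_num u1 u2 u3 u4; 2^-1 *: Z20_num u1 u2 u3 u4;
         15^-1 *: Z30_num u1 u2 u3 u4].

Lemma Z_at_tcomp : Z_at s = tcomp Z_of_h basic_h.
Proof.
apply: eq_4tuple; rewrite tcompE //= /Z_of_h /=.
- by rewrite comp_mpolyD !comp_mpolyXU.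
- by rewrite comp_mpolyZ rmorph_Z12_num /= !comp_mpolyXU -Z12E.
- by rewrite comp_mpolyZ rmorph_Z20_num /= !comp_mpolyXU -Z20E.
- by rewrite comp_mpolyZ rmorph_Z30_num /= !comp_mpolyXU -Z30E.
Qed.

Definition pderiv (v : 'I_4 -> C) (j : 'I_4) : {additive {mpoly C[4]} -> C} :=
  (meval v \o mderiv j).

Lemma pderivM v j (p q : {mpoly C[4]}) :
  pderiv v j (p * q) = pderiv v j p * q.@[v] + p.@[v] * pderiv v j q.
Proof. by rewrite /pderiv /= mderivM mevalD !mevalM. Qed.

Lemma pderivC v j c : pderiv v j c%:MP = 0.
Proof. by rewrite /pderiv /= mderivC meval0. Qed.

Lemma pderivXU v i j : pderiv v j 'X_i = (i == j)%:R.
Proof. by rewrite /pderiv /= mderivXU; case: eqP; rewrite ?meval1 ?meval0. Qed.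

Lemma pderivZ v j c p : pderiv v j (c *: p) = c * pderiv v j p.
Proof. by rewrite /pderiv /= mderivZ mevalZ. Qed.

(** If the determinant were zero, its matrix at [v] would have a nonzero row vector in its left
    kernel. *)
Lemma meval_det_neq0 (v : 'I_4 -> C) (t : 4.-tuple {mpoly C[4]}) :
    (forall x : 'rV[C]_4,
       (forall j, \sum_i x 0 i * pderiv v j (tnth t i) = 0) -> x = 0) ->
  \det (jac t) != 0.
Proof.
move=> H; apply/eqP => /(congr1 (meval v)); rewrite meval0 -det_map_mx => /eqP.
move=> /det0P[x x0 Hx]; case/negP: x0; apply/eqP/H => j.
have /rowP/(_ j) := Hx; rewrite !mxE => E; apply: etrans E.
by apply: eq_bigr => i _; rewrite !mxE.
Qed.

Lemma sum4 (F : 'I_4 -> C) : \sum_i F i =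
  F (@Ordinal 4 0 isT) + F (@Ordinal 4 1 isT) + F (@Ordinal 4 2 isT)
  + F (@Ordinal 4 3 isT).
Proof.
rewrite !big_ord_recr /= big_ord0 add0r.
by congr (F _ + F _ + F _ + F _); apply: val_inj.
Qed.

Lemma rV4_eq0 (x : 'rV[C]_4) :
  x 0 (@Ordinal 4 0 isT) = 0 -> x 0 (@Ordinal 4 1 isT) = 0 ->
  x 0 (@Ordinal 4 2 isT) = 0 -> x 0 (@Ordinal 4 3 isT) = 0 -> x = 0.
Proof.
move=> E0 E1 E2 E3; apply/rowP; case=> [[|[|[|[|//]]]]] Hi; rewrite mxE.
- by rewrite -[RHS]E0; congr (x _ _); apply: val_inj.
- by rewrite -[RHS]E1; congr (x _ _); apply: val_inj.
- by rewrite -[RHS]E2; congr (x _ _); apply: val_inj.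
- by rewrite -[RHS]E3; congr (x _ _); apply: val_inj.
Qed.

Lemma sum4_pderiv (x : 'rV[C]_4) v j (t : 4.-tuple {mpoly C[4]}) a0 a1 a2 a3 :
    pderiv v j t`_0 = a0 -> pderiv v j t`_1 = a1 ->
    pderiv v j t`_2 = a2 -> pderiv v j t`_3 = a3 ->
  \sum_i x 0 i * pderiv v j (tnth t i) =
  x 0 (@Ordinal 4 0 isT) * a0 + x 0 (@Ordinal 4 1 isT) * a1 +
  x 0 (@Ordinal 4 2 isT) * a2 + x 0 (@Ordinal 4 3 isT) * a3.
Proof. by move=> <- <- <- <-; rewrite sum4 !(tnth_nth 0). Qed.

Lemma pderiv_Z_of_h0 v j : pderiv v j Z_of_h`_0 = pderiv v j u1 + pderiv v j u4.
Proof. by rewrite -(raddfD (pderiv v j)). Qed.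

Lemma det_jac_Z_of_h : \det (jac Z_of_h) != 0.
Proof.
pose v (i : 'I_4) : C := [:: 0; 1; 1; 0]`_i.
apply: (@meval_det_neq0 v) => x Hx.
have v0 : (u1 : {mpoly C[4]}).@[v] = 0 by rewrite mevalXU.
have v1 : (u2 : {mpoly C[4]}).@[v] = 1 by rewrite mevalXU.
have v2 : (u3 : {mpoly C[4]}).@[v] = 1 by rewrite mevalXU.
have v3 : (u4 : {mpoly C[4]}).@[v] = 0 by rewrite mevalXU.
have D12 j := pderiv_Z12_num (pderivM v j) v0 v1 v2 v3.
have D20 j := pderiv_Z20_num (pderivM v j) v0 v1 v2 v3.
have D30 j := pderiv_Z30_num (pderivM v j) v0 v1 v2 v3.
have E j := etrans (esym (sum4_pderiv x (pderiv_Z_of_h0 v j)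
  (etrans (pderivZ v j 2^-1 _) (congr1 _ (D12 j)))
  (etrans (pderivZ v j 2^-1 _) (congr1 _ (D20 j)))
  (etrans (pderivZ v j 15^-1 _) (congr1 _ (D30 j))))) (Hx j).
have := E (@Ordinal 4 0 isT); have := E (@Ordinal 4 1 isT).
have := E (@Ordinal 4 2 isT); have := E (@Ordinal 4 3 isT).
rewrite !pderivXU /=.
move: (@rV4_eq0 x).
move: (x 0 _) (x 0 _) (x 0 _) (x 0 _) => x4 x3 x2 x1 concl E3 E2 E1 E0.
have {}E0 : x1 - x2 - 3 / 2 * x3 - 3 * x4 = 0 by rewrite -[RHS]E0; field.
have {}E1 : 3 * x2 + 9 * x4 = 0 by rewrite -[RHS]E1; field.
have {}E2 : 2 * x3 + 4 * x4 = 0 by rewrite -[RHS]E2; field.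
have {}E3 : x1 + 11 * x2 + 57 / 2 * x3 - 87 * x4 = 0.
  by rewrite -[RHS]E3; field.
have x40 : x4 = 0.
  (* The combination E3 - E0 - 4 E1 - 15 E2 eliminates x1, x2, x3 and leaves -180 x4. *)
  apply: (mulfI (_ : - 180 != 0)); first by rewrite oppr_eq0 pnatr_eq0.
  transitivity ((x1 + 11 * x2 + 57 / 2 * x3 - 87 * x4)
    - (x1 - x2 - 3 / 2 * x3 - 3 * x4)
    - 4 * (3 * x2 + 9 * x4) - 15 * (2 * x3 + 4 * x4)); first by field.
  by rewrite E0 E1 E2 E3 !mulr0 !subr0.
rewrite x40 !mulr0 ?addr0 ?subr0 in E0 E1 E2 *.
have x30 : x3 = 0.
  by apply: (mulfI (_ : 2 != 0)); rewrite ?pnatr_eq0 // E2 mulr0.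
have x20 : x2 = 0.
  by apply: (mulfI (_ : 3 != 0)); rewrite ?pnatr_eq0 // E1 mulr0.
by apply: concl => //; rewrite x30 x20 mulr0 !subr0 in E0.
Qed.

Hypothesis Hs : s * s = 5.

Lemma det_jac_basic_h : \det (jac basic_h) != 0.
Proof.
pose v (i : 'I_4) : C := [:: 1; 1; 2; 1]`_i.
apply: (@meval_det_neq0 v) => x Hx.
have v0 : (u1 : {mpoly C[4]}).@[v] = 1 by rewrite mevalXU.
have v1 : (u2 : {mpoly C[4]}).@[v] = 1 by rewrite mevalXU.
have v2 : (u3 : {mpoly C[4]}).@[v] = 2 by rewrite mevalXU.
have v3 : (u4 : {mpoly C[4]}).@[v] = 1 by rewrite mevalXU.
have D2 j := pderiv_h2_of (pderivM v j) v0 v1 v2.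
have D6 j := pderiv_h6_of (pderivM v j) (pderivC v j s) v0 v1 v2.
have D10 j := pderiv_h10_of (pderivM v j) (pderivC v j s) v0 v1 v2.
have D4 j : pderiv v j (u4 ^+ 2) = 2 * pderiv v j u4.
  by rewrite (pderivXn (pderivM v j)) /= v3 expr1 mulr1.
have B6 j : pderiv v j basic_h`_1 = _ := etrans (congr1 _ (h6E s)) (D6 j).
have B10 j : pderiv v j basic_h`_2 = _ := etrans (congr1 _ (h10E s)) (D10 j).
have E j := etrans (esym (sum4_pderiv x (D2 j : pderiv v j basic_h`_0 = _)
  (B6 j) (B10 j) (D4 j))) (Hx j).
have := E (@Ordinal 4 0 isT); have := E (@Ordinal 4 1 isT).
have := E (@Ordinal 4 2 isT); have := E (@Ordinal 4 3 isT).
rewrite !pderivXU /= !mevalC.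
move: (@rV4_eq0 x).
move: (x 0 _) (x 0 _) (x 0 _) (x 0 _) => x4 x3 x2 x1 concl E3 E2 E1 E0.
have x40 : x4 = 0.
  by apply: (mulfI (_ : 2 != 0)); rewrite ?pnatr_eq0 // mulr0 -[RHS]E3; ring.
(* E0 - E1 cancels the rational parts, and below E0 + E1 - E2 cancels the parts in [s]; x1 drops out
   of both. *)
have {}E01 : 36 * (s * (x2 + 27 * x3)) = 0.
  by rewrite -[RHS](subrr 0) -{1}E0 -E1; ring.
have {}E012 : - 60 * (x2 + 5 * x3) = 0.
  rewrite -[RHS](subrr 0) -[X in X - _](addr0 0) -{1}E0 -{1}E1 -E2; ring.
have s0 : s != 0.
  by apply/eqP => s0; move/eqP: Hs; rewrite s0 mul0r eq_sym pnatr_eq0.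
have {}E01 : x2 + 27 * x3 = 0.
  apply: (mulfI s0); apply: (mulfI (_ : 36 != 0)); first by rewrite pnatr_eq0.
  by rewrite E01 !mulr0.
have {}E012 : x2 + 5 * x3 = 0.
  apply: (mulfI (_ : - 60 != 0)); first by rewrite oppr_eq0 pnatr_eq0.
  by rewrite E012 mulr0.
have x30 : x3 = 0.
  apply: (mulfI (_ : 22 != 0)); first by rewrite pnatr_eq0.
  transitivity ((x2 + 27 * x3) - (x2 + 5 * x3)); first by ring.
  by rewrite E01 E012 subrr mulr0.
have x20 : x2 = 0 by rewrite -[RHS]E012 x30 mulr0 addr0.
apply: concl => //; apply: (mulfI (_ : 2 != 0)); rewrite ?pnatr_eq0 //.
by rewrite mulr0 -[RHS]E0 x20 x30; ring.
Qed.

(** The two determinants were tested at unrelated points. The outer one stays nonzero after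
    substituting [basic_h], whose entries are algebraically independent. *)
Lemma det_jac_Z_at : \det (jac (Z_at s)) != 0.
Proof.
rewrite Z_at_tcomp jac_comp det_mulmx.
apply: mulf_neq0; last exact: det_jac_basic_h.
rewrite det_map_mx.
apply: contraNneq det_jac_Z_of_h => H; apply/eqP.
exact: jac_independent det_jac_basic_h _ H.
Qed.

End JacobianNonzero.

(** * The mirrors *)

(* [(a, b)] stands for [a + b * phi], and a 4-tuple of such pairs for a linear
   form in [u1, ..., u4]. *)
Definition zphi := (int * int)%type.
Definition zphi_add (x y : zphi) : zphi := (x.1 + y.1, x.2 + y.2).
Definition zphi_opp (x : zphi) : zphi := (- x.1, - x.2).
Definition zphi_mul (x y : zphi) : zphi :=
  (x.1 * y.1 + x.2 * y.2, x.1 * y.2 + x.2 * y.1 + x.2 * y.2).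
Definition form := (zphi * zphi * zphi * zphi)%type.

Definition flip_form (l : form) : form :=
  let: (a, b, c, d) := l in (a, b, c, zphi_opp d).
Definition cycle_form (l : form) : form :=
  let: (a, b, c, d) := l in (c, a, b, d).
Definition swap_form (l : form) : form :=
  let: (a, b, c, d) := l in (b, a, d, c).
(* The result is twice the composite with the reflection. *)
Definition reflection_form (l : form) : form :=
  let: (a, b, c, d) := l in
  let phi := (0, 1) in let phi' := (-1, 1) in
  let p := zphi_add a (zphi_add (zphi_mul phi b) (zphi_mul phi' c)) in
  let dbl x := zphi_add x x in
  (zphi_add (dbl a) (zphi_opp p), zphi_add (dbl b) (zphi_opp (zphi_mul phi p)),
   zphi_add (dbl c) (zphi_opp (zphi_mul phi' p)), dbl d).

Definition zphi_even (x : zphi) := (2 %| x.1)%Z && (2 %| x.2)%Z.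
Definition zphi_half (x : zphi) : zphi := ((x.1 %/ 2)%Z, (x.2 %/ 2)%Z).
Definition half_form (l : form) : form :=
  let: (a, b, c, d) := l in
  if [&& zphi_even a, zphi_even b, zphi_even c & zphi_even d]
  then (zphi_half a, zphi_half b, zphi_half c, zphi_half d) else l.

Definition opp_form (l : form) : form :=
  let: (a, b, c, d) := l in (zphi_opp a, zphi_opp b, zphi_opp c, zphi_opp d).

Definition add_form (s : seq form) (l : form) :=
  if (l \in s) || (opp_form l \in s) then s else rcons s l.

(* Forms come out multiplied by 1, 2 or 4, whence the two halvings. *)
Definition extend_forms (s : seq form) :=
  foldl add_form s
    [seq half_form (half_form l) | l <- map flip_form s ++ map cycle_form s
       ++ map swap_form s ++ map reflection_form s].

(* The orbit of [u4], up to sign; nine steps reach all of it. *)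
Definition mirror_forms : seq form :=
  iter 9 extend_forms [:: ((0, 0), (0, 0), (0, 0), (1, 0))].

Definition coords (l : form) : seq zphi :=
  let: (a, b, c, d) := l in [:: a; b; c; d].

Definition nonprop_form (l m : form) : bool :=
  let co l i := nth (0, 0) (coords l) i in
  has (fun i => has (fun j =>
    zphi_mul (co l i) (co m j) != zphi_mul (co l j) (co m i))
    (iota 0 4)) (iota 0 4).

(** This is 1 + 11 + 19 + 29, the degree of J. *)
Lemma size_mirror_forms : size mirror_forms = 60%N.
Proof. by vm_compute. Qed.

Lemma nonprop_mirror_forms :
  pairwise (fun l m => nonprop_form m l) mirror_forms.
Proof. by vm_compute. Qed.

Section Mirrors.

Variables (C : numClosedFieldType) (s : C).
Hypothesis Hs : s * s = 5.

Definition zval (x : zphi) : C := x.1%:~R + x.2%:~R * phi s.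

Lemma zvalD x y : zval (zphi_add x y) = zval x + zval y.
Proof. by rewrite /zval !rmorphD /=; ring. Qed.

Lemma zvalN x : zval (zphi_opp x) = - zval x.
Proof. by rewrite /zval !rmorphN /=; ring. Qed.

Lemma zvalM x y : zval (zphi_mul x y) = zval x * zval y.
Proof.
have H := phi_sqr Hs; rewrite /zval /= !(rmorphD, rmorphM) /=; ring: H.
Qed.

(** The exponent of 5 would be even on the left and odd on the right. *)
Lemma square_eq5 (a b : nat) : (a ^ 2 = 5 * b ^ 2)%N -> b = 0%N.
Proof.
case: (posnP b) => // b0 E; have := congr1 (logn 5) E.
rewrite lognM ?expn_gt0 ?b0 // !lognX (_ : logn 5 5 = 1%N) // => /(congr1 odd).
by rewrite oddD !oddM.
Qed.

(** Doubling a + b phi = 0 gives 2 a + b = - b s, whose square contradicts irrationality of the root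
    of 5 unless b = 0. Thus minors found nonzero by computation stay nonzero in [C]. *)
Lemma zval_eq0 x : zval x = 0 -> x = (0, 0).
Proof.
case: x => a b; rewrite /zval /= => E.
have E2 : (2 * a + b)%:~R = - b%:~R * s :> C.
  apply/eqP; rewrite -subr_eq0 mulNr opprK rmorphD rmorphM /= -addrA.
  rewrite -[X in _ + (X + _)]mulr1 -mulrDr -double_phi mulrCA -mulrDr.
  by rewrite E mulr0.
have E5 : (2 * a + b) ^+ 2 = 5 * b ^+ 2.
  apply: (@intr_inj C); rewrite rmorphXn /= E2 rmorphM rmorphXn /=.
  by ring: Hs.
have b0 : b = 0.
  apply/eqP; rewrite -absz_eq0; apply/eqP.
  apply: (@square_eq5 (absz (2 * a + b))).
  by have := congr1 absz E5; rewrite abszM !abszX.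
move: E; rewrite b0 mul0r addr0 => /eqP; rewrite intr_eq0 => /eqP ->.
by [].
Qed.

Lemma zval_inj : injective zval.
Proof.
move=> x y E; have : zval (zphi_add x (zphi_opp y)) = 0.
  by rewrite zvalD zvalN E subrr.
move/zval_eq0; case: x {E} => a b; case: y => c d [] /eqP + /eqP.
by rewrite !subr_eq0 => /eqP -> /eqP ->.
Qed.

Definition form_coef (l : form) (i : 'I_4) : C :=
  zval (nth (0, 0) (coords l) i).

Lemma nonprop_form_coef l m :
  nonprop_form l m -> nonprop (form_coef l) (form_coef m).
Proof.
move=> /hasP[k]; rewrite mem_iota => Hk /hasP[j]; rewrite mem_iota => Hj H.
exists (Ordinal (Hk : (k < 4)%N)), (Ordinal (Hj : (j < 4)%N)).
by rewrite /form_coef /= -!zvalM (inj_eq zval_inj).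
Qed.

Definition zval_poly x : {mpoly C[4]} := (zval x)%:MP.

Lemma linform4 (a b c d : zphi) : linform (form_coef (a, b, c, d)) =
  zval_poly a * u1 + zval_poly b * u2 + zval_poly c * u3 + zval_poly d * u4.
Proof.
rewrite /linform !big_ord_recr /= big_ord0 add0r /form_coef /= /zval_poly.
rewrite !mul_mpolyC.
by congr (_ *: 'X_ _ + _ *: 'X_ _ + _ *: 'X_ _ + _ *: 'X_ _); apply: val_inj.
Qed.

Lemma zval_polyD x y : zval_poly (zphi_add x y) = zval_poly x + zval_poly y.
Proof. by rewrite /zval_poly zvalD mpolyCD. Qed.

Lemma zval_polyN x : zval_poly (zphi_opp x) = - zval_poly x.
Proof. by rewrite /zval_poly zvalN mpolyCN. Qed.

Lemma zval_polyM x y : zval_poly (zphi_mul x y) = zval_poly x * zval_poly y.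
Proof. by rewrite /zval_poly zvalM mpolyCM. Qed.

Lemma comp_linform4 (t : 4.-tuple {mpoly C[4]}) (a b c d : zphi) :
  linform (form_coef (a, b, c, d)) \mPo t =
  zval_poly a * t`_0 + zval_poly b * t`_1 + zval_poly c * t`_2
  + zval_poly d * t`_3.
Proof.
by rewrite linform4 !comp_mpolyD !rmorphM /= !comp_mpolyC !comp_mpolyXU.
Qed.

Lemma linform_half l : exists2 k : C, k != 0 &
  linform (form_coef l) = k *: linform (form_coef (half_form l)).
Proof.
case: l => [[[a b] c] d] /=; case: ifP => [/and4P[Ha Hb Hc Hd]|_].
  exists 2; first by rewrite pnatr_eq0.
  have E x : zphi_even x -> zval_poly x = 2 * zval_poly (zphi_half x).
    case: x => x y /andP[/= /divzK Hx /divzK Hy].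
    rewrite /zval_poly -mpolyC_nat -mpolyCM; congr _%:MP.
    by rewrite /zval /= -{1}Hx -{1}Hy !rmorphM /=; ring.
  rewrite !linform4 (E a) // (E b) // (E c) // (E d) // -mul_mpolyC mpolyC_nat.
  by ring.
by exists 1; rewrite ?oner_eq0 // scale1r.
Qed.

Definition mirror_divides (l : form) (p : {mpoly C[4]}) :=
  divides (linform (form_coef l)) p.

Lemma mirror_divides_half l p :
  mirror_divides l p -> mirror_divides (half_form l) p.
Proof.
have [k k0 E] := linform_half l; rewrite /mirror_divides E.
exact: divides_scale.
Qed.

Lemma comp_flip l :
  linform (form_coef l) \mPo flip_map C = linform (form_coef (flip_form l)).
Proof.
case: l => [[[a b] c] d]; rewrite comp_linform4 linform4 zval_polyN /=.
by rewrite mulrN mulNr.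
Qed.

Lemma comp_cycle l :
  linform (form_coef l) \mPo cycle_map C = linform (form_coef (cycle_form l)).
Proof.
by case: l => [[[a b] c] d]; rewrite comp_linform4 linform4 /=; ring.
Qed.

Lemma comp_swap l :
  linform (form_coef l) \mPo swap_map C = linform (form_coef (swap_form l)).
Proof.
by case: l => [[[a b] c] d]; rewrite comp_linform4 linform4 /=; ring.
Qed.

Lemma zval_poly_phi : zval_poly (0, 1) = (phi s)%:MP.
Proof. by rewrite /zval_poly /zval /= add0r mul1r. Qed.

Lemma zval_poly_phi1 : zval_poly (-1, 1) = (phi s)%:MP - 1.
Proof. by rewrite /zval_poly /zval /= mul1r mpolyCD addrC mpolyCN mpolyC1. Qed.

Lemma comp_reflection_form l :
  2 *: (linform (form_coef l) \mPo reflection_map s) =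
  linform (form_coef (reflection_form l)).
Proof.
case: l => [[[a b] c] d]; rewrite -mul_mpolyC mpolyC_nat comp_linform4.
rewrite linform4 !(zval_polyD, zval_polyN, zval_polyM).
rewrite zval_poly_phi zval_poly_phi1.
have [E0 E1 E2] := scale2_reflection s.
have D (x y z t x' y' z' t' : {mpoly C[4]}) :
    2 * (x * x' + y * y' + z * z' + t * t')
    = x * (2 * x') + y * (2 * y') + z * (2 * z') + t * (2 * t') by ring.
rewrite D E0 E1 E2 /=.
move: (zval_poly a) (zval_poly b) (zval_poly c) (zval_poly d) (phi s)%:MP.
by move=> za zb zc zd g; ring.
Qed.

(** If [l] divides [p], then [l \mPo g] divides [p \mPo g], hence [p]; so the forms dividing [p] are
    stable under the steps that build the orbit. *)
Lemma mirror_forms_divide (p : {mpoly C[4]}) :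
    (forall g, g \in H4_gens s ->
       exists c : {mpoly C[4]}, p = c * (p \mPo g)) ->
    mirror_divides ((0, 0), (0, 0), (0, 0), (1, 0)) p ->
  forall l, l \in mirror_forms -> mirror_divides l p.
Proof.
move=> Hp H0.
pose ok (S : seq form) := forall l, l \in S -> mirror_divides l p.
have step g l : g \in H4_gens s -> mirror_divides l p ->
    divides (linform (form_coef l) \mPo g) p.
  move=> Hg Hl; have [c ->] := Hp g Hg.
  by apply: divides_mull; apply: divides_comp.
have ext S : ok S -> ok (extend_forms S).
  move=> HS; rewrite /extend_forms.
  set r := [seq half_form (half_form l) | l <- _].
  have : ok r.
    move=> l' /mapP[l Hl ->]; apply/mirror_divides_half/mirror_divides_half.
    move: Hl; rewrite !mem_cat => /or4P[] /mapP[m /HS Hm ->].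
    - by rewrite /mirror_divides -comp_flip; apply: step; rewrite // !inE eqxx.
    - rewrite /mirror_divides -comp_cycle.
      by apply: step; rewrite // !inE eqxx ?orbT.
    - rewrite /mirror_divides -comp_swap.
      by apply: step; rewrite // !inE eqxx ?orbT.
    rewrite /mirror_divides -comp_reflection_form.
    have [] : divides (linform (form_coef m) \mPo reflection_map s) p.
      by apply: step; rewrite // !inE eqxx ?orbT.
    (* [reflection_form] is twice the composite form, so the cofactor is halved. *)
    move=> q ->; exists (2^-1 *: q); rewrite -scalerAl -scalerAr scalerA.
    by rewrite mulVf ?scale1r // pnatr_eq0.
  clearbody r; elim: r S HS => //= l r IHr S HS Hr.
  apply: IHr => [m|m Hm]; last by apply: Hr; rewrite inE Hm orbT.
  rewrite /add_form; case: ifP => _; first exact: HS.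
  by rewrite mem_rcons inE => /orP[/eqP ->|/HS//]; apply: Hr; rewrite mem_head.
rewrite /mirror_forms; elim: (9%N) => [|k IHk]; last first.
  by rewrite iterS; apply: ext.
by move=> l; rewrite inE => /eqP ->.
Qed.

End Mirrors.

(** * Invariants of H4 as polynomials in the Z's *)

Section InvariantRing.

Variables (C : numClosedFieldType) (s : C).
Hypothesis Hs : s * s = 5.

Lemma gens_linear g : g \in H4_gens s -> forall i, tnth g i \is 1.-homog.
Proof.
rewrite !inE => /or4P[] /eqP ->; case=> [[|[|[|[|//]]]]] Hi;
  rewrite (tnth_nth 0) /= ?dhomogN ?homog_var //; solve_dhomog.
Qed.

Lemma det_jac_flip : \det (jac (flip_map C)) = -1.
Proof.
pose d : 'rV[{mpoly C[4]}]_4 := \row_i (-1) ^+ (i == 3 :> nat).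
have -> : jac (flip_map C) = diag_mx d.
  apply/matrixP => i j; rewrite !mxE.
  case: i => [[|[|[|[|//]]]]] Hi; rewrite (tnth_nth 0) /= ?mderivN mderivXU.
  - by rewrite expr0.
  - by rewrite expr0.
  - by rewrite expr0.
  - by rewrite expr1 mulNrn.
rewrite det_diag !big_ord_recr /= big_ord0 !mxE /=.
by rewrite expr0 expr1 !mul1r.
Qed.

(** The flip is the identity on [u4 = 0], so there the restriction of [p] equals its own opposite
    and vanishes. *)
Lemma flip_antiinvariant p :
  p = \det (jac (flip_map C)) * (p \mPo flip_map C) ->
  mirror_divides s ((0, 0), (0, 0), (0, 0), (1, 0)) p.
Proof.
rewrite det_jac_flip mulN1r => Hp.
pose a := form_coef s ((0, 0), (0, 0), (0, 0), (1, 0)).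
have a3 : a (@Ordinal 4 3 isT) = 1.
  by rewrite /a /form_coef /zval /= mul0r addr0.
have a3_neq0 : a (@Ordinal 4 3 isT) != 0 by rewrite a3 oner_eq0.
have Ea : linform a = u4.
  rewrite linform4 /zval_poly /zval /= mul0r !addr0 mpolyC0 mpolyC1.
  by rewrite !mul0r !add0r mul1r.
rewrite /mirror_divides -/a (divides_linformP _ a3_neq0).
set t := hyperplane_proj _ _.
have Et : tcomp (flip_map C) t = t.
  have Et3 : t`_3 = 0.
    rewrite -(tnth_nth 0 t (@Ordinal 4 3 isT)) tnth_mktuple eqxx a3 invr1.
    by rewrite scale1r Ea subrr.
  apply: eq_4tuple; rewrite tcompE //= ?comp_mpolyN comp_mpolyXU //=.
  by rewrite Et3 oppr0.
have E : p \mPo t = - (p \mPo t).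
  by rewrite {1}Hp comp_mpolyN comp_mpolyA Et.
move/eqP: E; rewrite -addr_eq0 -mulr2n -scaler_nat scaler_eq0 pnatr_eq0 /=.
by move/eqP.
Qed.

Theorem Z_at_expression (e : nat) (p : {mpoly C[4]}) :
    invariant (H4_gens s) p -> p \is e.-homog ->
  exists2 q : {mpoly C[4]}, q \is e.-homog for (wdeg degs) & q \mPo Z_at s = p.
Proof.
(* The orbit is replaced by an arbitrary list with its proved properties, so that it is not
   evaluated again. *)
move: mirror_forms size_mirror_forms nonprop_mirror_forms
  (@mirror_forms_divide C s Hs) => forms sz np dv.
pose l0 : form := (0, 0, (0, 0), (0, 0), (0, 0)).
pose mirrors := map (form_coef s) forms.
have szm : size mirrors = 60%N by rewrite size_map sz.
have nthE k : (k < 60)%N ->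
    nth (fun=> 0) mirrors k = form_coef s (nth l0 forms k).
  by move=> Hk; rewrite (nth_map l0) // sz.
apply: (@invariant_expression _ _ _ (det_jac_Z_at Hs) _ _ mirrors).
- exact: gens_linear.
- exact: Z_at_invariant.
- by case=> [[|[|[|[|//]]]]].
- exact: Z_at_homog.
- move=> k j; rewrite szm => /andP[Hkj Hj]; have Hk := ltn_trans Hkj Hj.
  rewrite !nthE //; apply: nonprop_form_coef => //.
  by have /(pairwiseP l0) := np; apply=> //; rewrite inE sz.
- by rewrite szm !big_ord_recr /= big_ord0.
move=> q Hq k; rewrite szm => Hk; rewrite nthE //; apply: dv.
- by move=> g Hg; exists (\det (jac g)); exact: Hq.
- by apply: flip_antiinvariant; apply: Hq; rewrite !inE eqxx.
- by apply: mem_nth; rewrite sz.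
Qed.

End InvariantRing.

(** * Poles in [w0] *)

Section Polynomiality.

Variable C : numClosedFieldType.

Lemma is_polynomialD (x y : {fraction {mpoly C[4]}}) :
  is_polynomial x -> is_polynomial y -> is_polynomial (x + y).
Proof. by move=> [p ->] [q ->]; exists (p + q); rewrite rmorphD. Qed.

Lemma is_polynomialN (x : {fraction {mpoly C[4]}}) :
  is_polynomial x -> is_polynomial (- x).
Proof. by move=> [p ->]; exists (- p); rewrite rmorphN. Qed.

Lemma is_polynomialM (x y : {fraction {mpoly C[4]}}) :
  is_polynomial x -> is_polynomial y -> is_polynomial (x * y).
Proof. by move=> [p ->] [q ->]; exists (p * q); rewrite rmorphM. Qed.

Lemma is_polynomialX (x : {fraction {mpoly C[4]}}) k :
  is_polynomial x -> is_polynomial (x ^+ k).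
Proof. by move=> [p ->]; exists (p ^+ k); rewrite rmorphXn. Qed.

Lemma is_polynomial_nat k : is_polynomial (k%:R : {fraction {mpoly C[4]}}).
Proof. by exists k%:R; rewrite rmorph_nat. Qed.

Lemma is_polynomialV_nat k : is_polynomial (k%:R^-1 : {fraction {mpoly C[4]}}).
Proof.
exists (k%:R^-1)%:MP.
have -> : tofrac ((k%:R^-1)%:MP_[4] : {mpoly C[4]})
    = (@tofrac {mpoly C[4]} \o @mpolyC 4 C) (k%:R^-1) by [].
by rewrite fmorphV rmorph_nat.
Qed.

Lemma is_polynomial_tofrac (p : {mpoly C[4]}) : is_polynomial (tofrac p).
Proof. by exists p. Qed.

Lemma w0_pole (x : {fraction {mpoly C[4]}}) (k a b : nat) : (b <= k + a)%N ->
  w0 C ^+ k * (- w0 C) ^+ a * (x / (105 * w0 C)) ^+ b =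
  (-1) ^+ a * (x / 105) ^+ b * w0 C ^+ (k + a - b).
Proof.
move=> Hb; have w0_neq0 : w0 C != 0.
  by rewrite tofrac_eq0 -msupp_eq0 msuppX.
have -> : x / (105 * w0 C) = x / 105 * (w0 C)^-1 by rewrite invfM mulrA.
rewrite -[- w0 C]mulN1r !(exprMn _ (- 1)) !(exprMn _ (x / 105)) exprVn.
rewrite (mulrCA _ ((- 1) ^+ a)) -!mulrA; congr (_ * _).
rewrite (mulrCA _ ((x / 105) ^+ b)) (mulrCA _ ((x / 105) ^+ b)); congr (_ * _).
apply: (mulIf (expf_neq0 b w0_neq0)).
by rewrite -!mulrA mulVf ?expf_neq0 // mulr1 -!exprD subnK.
Qed.

(** Only the value of Z12 has a denominator in [w0], of order one, and each Z2 contributes a zero of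
    order one; [a] and [b] are the exponents of Z2 and Z12. *)
Lemma substZ_polynomial (k e : nat) (q : {mpoly C[4]}) :
    q \is e.-homog for (wdeg degs) ->
    (forall a b c d : nat,
       2 * a + 12 * b + 20 * c + 30 * d = e -> b <= k + a)%N ->
  is_polynomial (w0 C ^+ k * substZ q).
Proof.
move=> /dhomogP Hq Hk; rewrite /substZ /mmap mulr_sumr big_seq.
apply: big_ind => [|x y|m Hm]; first by exists 0; rewrite rmorph0.
  exact: is_polynomialD.
rewrite mulrCA; apply: is_polynomialM; first exact: is_polynomial_tofrac.
have := Hq m Hm; rewrite /mmap1 /= /wdeg !big_ord_recr !big_ord0 /= mul1r add0n.
rewrite !(tnth_nth 0%N) !(tnth_nth 0) /=.
move: (m _) (m _) (m _) (m _) => d c b a /Hk Hb.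
have -> (x y z t r : {fraction {mpoly C[4]}}) :
    x * (y * z * t * r) = x * y * z * (t * r) by rewrite !mulrA.
rewrite (w0_pole _ Hb).
by do ![exact: is_polynomial_nat | exact: is_polynomialV_nat
  | exact: is_polynomial_tofrac | apply: is_polynomialX | apply: is_polynomialM
  | apply: is_polynomialD | apply: is_polynomialN].
Qed.

Let s : C := sqrtC 5.

Lemma Y_invariant i : invariant (H4_gens s) (tnth (Z_at (- s)) i \mPo P C).
Proof.
have Hs' : - s * - s = 5 by rewrite mulrNN sqrt5_sqr.
move=> g /P_equivariant[g' Hg' E].
by rewrite comp_mpolyA E -comp_mpolyA (Z_at_invariant Hs' Hg').
Qed.

Lemma Y_expression (i : 'I_4) (k : nat) :
    (forall a b c d : nat, 2 * a + 12 * b + 20 * c + 30 * d = tnth degs i * 7 ->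
       b <= k + a)%N ->
  exists Q, is_expression_in_Z (tnth (Z_at (- s)) i \mPo P C) Q
    /\ is_polynomial (w0 C ^+ k * substZ Q).
Proof.
move=> Hk.
have [Q HQ EQ] :=
  Z_at_expression (sqrt5_sqr C) (@Y_invariant i) (Y_homog (- s) i).
exists Q; split; last exact: substZ_polynomial HQ Hk.
split=> [|Q' EQ']; first exact: EQ.
apply/eqP; rewrite -subr_eq0; apply/eqP.
apply: (jac_independent (det_jac_Z_at (sqrt5_sqr C))).
have {}EQ' : Q' \mPo Z_at s = tnth (Z_at (- s)) i \mPo P C := EQ'.
by rewrite comp_mpolyB EQ EQ' subrr.
Qed.

Lemma Y_nth : [/\ tnth (Z_at (- s)) (@Ordinal 4 0 isT) \mPo P C = Y2 C,
  tnth (Z_at (- s)) (@Ordinal 4 1 isT) \mPo P C = Y12 C,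
  tnth (Z_at (- s)) (@Ordinal 4 2 isT) \mPo P C = Y20 C
  & tnth (Z_at (- s)) (@Ordinal 4 3 isT) \mPo P C = Y30 C].
Proof. by split; rewrite (tnth_nth 0). Qed.

Lemma Y_expressions :
  exists Q2 Q12 Q20 Q30 : {mpoly C[4]},
    [/\ is_expression_in_Z (Y2 C) Q2, is_expression_in_Z (Y12 C) Q12,
        is_expression_in_Z (Y20 C) Q20 & is_expression_in_Z (Y30 C) Q30] /\
    [/\ is_polynomial (substZ Q2), is_polynomial (w0 C ^+ 7 * substZ Q12),
        is_polynomial (w0 C ^+ 10 * substZ Q20)
      & is_polynomial (w0 C ^+ 15 * substZ Q30)].
Proof.
have [|Q2 [E2 p2]] := @Y_expression (@Ordinal 4 0 isT) 0.
  (* In weight 14 an exponent b = 1 forces a = 1, since the remaining weight 2 can only be Z2; hence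
     no pole. *)
  by move=> a b c d; rewrite (tnth_nth 0%N) /=; lia.
have [|Q12 [E12 p12]] := @Y_expression (@Ordinal 4 1 isT) 7.
  by move=> a b c d; rewrite (tnth_nth 0%N) /=; lia.
have [|Q20 [E20 p20]] := @Y_expression (@Ordinal 4 2 isT) 10.
  (* In weight 140, b can reach 11, but the remaining weight 8 is then Z2^4; so b - a is at most 10.
     Weight 210 below behaves likewise for b = 16 and 17. *)
  by move=> a b c d; rewrite (tnth_nth 0%N) /=; lia.
have [|Q30 [E30 p30]] := @Y_expression (@Ordinal 4 3 isT) 15.
  by move=> a b c d; rewrite (tnth_nth 0%N) /=; lia.
have [Y2E Y12E Y20E Y30E] := Y_nth; rewrite expr0 mul1r in p2.
rewrite Y2E in E2; rewrite Y12E in E12.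
rewrite Y20E in E20; rewrite Y30E in E30.
exists Q2, Q12, Q20, Q30; split; split.
- exact: E2.
- exact: E12.
- exact: E20.
- exact: E30.
- exact: p2.
- exact: p12.
- exact: p20.
- exact: p30.
Qed.

End Polynomiality.

Theorem mainTheorem3 (R : realType) :
  exists Q2 Q12 Q20 Q30 : {mpoly R[i][4]},
    [/\ is_expression_in_Z (Y2 R[i]) Q2,
        is_expression_in_Z (Y12 R[i]) Q12,
        is_expression_in_Z (Y20 R[i]) Q20
      & is_expression_in_Z (Y30 R[i]) Q30] /\
    [/\ is_polynomial (substZ Q2),
        is_polynomial (w0 R[i] ^+ 7 * substZ Q12),
        is_polynomial (w0 R[i] ^+ 10 * substZ Q20)
      & is_polynomial (w0 R[i] ^+ 15 * substZ Q30)].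
Proof. exact: Y_expressions. Qed.
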